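(* Let $\mathbf{Y}=X\boldsymbol\beta+\boldsymbol\epsilon$ with fixed $X\in\mathbb{R}^{n\times p}$, $\boldsymbol\epsilon\sim\mathcal{N}(\mathbf{0},\sigma^2I_n)$, known $\sigma>0$, and $S=\{j:\beta_j\ne0\}$. Fix a split of the $n$ observations into selection data of size $n_1$ and the remaining $n_2$ observations, and let $\tilde S$, $\tilde s=|\tilde S|$, be the Lasso-selected set based on the selection data. Assume that the screening property $\tilde S\supseteq S$ holds, and that $\tilde s<n_1$ and $\mathrm{rank}(X_{1,\tilde S})=\tilde s$. Let $G\subseteq\{1,\dots,p\}$ be a group, $\tilde G=G\cap\tilde S$, and for a realization $\mathbf{y}$ of $\mathbf{Y}$ define $$p_G(\mathbf{y})=\begin{cases}p_{\tilde G}(\mathbf{y})&\text{if }|\tilde G|>0,\\1&\text{otherwise,}\end{cases}$$ where $$p_{\tilde G}(\mathbf{y})=\mathrm{P}\bigg[\sum_{j\in\tilde G}\mathrm{sign}(\widehat\beta_j)(X_{\tilde S}^+)_j\mathbf{Y}\ \ge\ \sum_{j\in\tilde G}\mathrm{sign}(\widehat\beta_j)(X_{\tilde S}^+)_j\mathbf{y}\ \bigg|\ \boldsymbol\beta^{\tilde S}_{\tilde G}=\mathbf{0},\ (X_{\tilde S\setminus\tilde G})^\top\mathbf{Y}=(X_{\tilde S\setminus\tilde G})^\top\mathbf{y},\ A\mathbf{Y}\le\mathbf{b}\bigg].$$ Then, under the null hypothesis that $\beta_j=0$ for all $j\in G$, for any $\alpha\in(0,1]$, conditionally on the selection event (the Lasso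 selecting $\tilde S$ with the given signs), if $\alpha<1$ or $|\tilde G|>0$ or not, $$\mathrm{P}[p_G(\mathbf{Y})\le\alpha]\le\alpha.$$
   Context: Notation. $X_M$ is $X$ restricted to columns in $M$; $(X_1,\mathbf{Y}_1)$ are the rows of $(X,\mathbf{Y})$ in the selection data, $X_{1,M}$ is $X_1$ restricted to columns $M$; $X_M^+=(X_M^\top X_M)^{-1}X_M^\top$, with $(X_M^+)_j$ its row corresponding to variable $j\in M$. The submodel coefficient is $\boldsymbol\beta^{\tilde S}=\arg\min_{\mathbf{b}}\mathbb{E}\|\mathbf{Y}-X_{\tilde S}\mathbf{b}\|^2=X_{\tilde S}^+X\boldsymbol\beta$ (indexed by $\tilde S$), and $\boldsymbol\beta^{\tilde S}_{\tilde G}$ is its restriction to $\tilde G$. Selection. With a predetermined $\lambda>0$, $\widehat{\boldsymbol\beta}=\arg\min_{\mathbf{b}\in\mathbb{R}^p}\tfrac12\|\mathbf{Y}_1-X_1\mathbf{b}\|_2^2+\lambda\|\mathbf{b}\|_1$ (assumed uniquely defined), $\tilde S=\{j:\widehat\beta_j\ne0\}$, and $\widehat{\boldsymbol\xi}=(\mathrm{sign}(\widehat\beta_j))_{j\in\tilde S}$. Selection event and conditioning. Inference is conditional on the selection event that the Lasso on $(X_1,\mathbf{Y}_1)$ selects a given set with given signs (an event of positive probability); in the statement $\tilde S$, the signs $\mathrm{sign}(\widehat\beta_j)$, $j\in\tilde S$, and hence $A,\mathbf{b}$ below, are treated as fixed at these values. The selection event is a set of linear inequalities in $\mathbf{Y}_1$,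 of which only the ''active'' ones enter the p-value: $$A\mathbf{Y}\le\mathbf{b}\ :\iff\ -\mathrm{diag}(\widehat{\boldsymbol\xi})(X_{1,\tilde S}^\top X_{1,\tilde S})^{-1}X_{1,\tilde S}^\top\mathbf{Y}_1\le-\lambda\,\mathrm{diag}(\widehat{\boldsymbol\xi})(X_{1,\tilde S}^\top X_{1,\tilde S})^{-1}\widehat{\boldsymbol\xi}.$$ The remaining (''inactive'') constraints involve $\mathbf{Y}_1$ only through its projection onto the orthogonal complement of the column space of $X_{1,\tilde S}$. The probability defining $p_{\tilde G}(\mathbf{y})$ is computed under $\mathbf{Y}\sim\mathcal{N}(X_{\tilde S}\boldsymbol\beta^{\tilde S},\sigma^2I_n)$ with $\boldsymbol\beta^{\tilde S}_{\tilde G}=\mathbf{0}$, with $\tilde S$ and the signs fixed; it does not depend on the other coordinates of $\boldsymbol\beta^{\tilde S}$. *)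

(* Defs.v *)
From HB Require Import structures.
From mathcomp Require Import all_boot all_order all_algebra.
From mathcomp Require Import all_classical all_reals all_analysis.

Set Implicit Arguments.
Unset Strict Implicit.
Unset Printing Implicit Defensive.

Import Order.TTheory GRing.Theory Num.Theory.
Import numFieldNormedType.Exports.

Local Open Scope classical_set_scope.
Local Open Scope ring_scope.

Definition cols (R : Type) (n p : nat) (M : {set 'I_p}) (X : 'M[R]_(n, p)) :
  'M[R]_(n, #|M|) := colsub (@enum_val _ (mem M)) X.

Definition rows (R : Type) (n p : nat) (I : {set 'I_n}) (X : 'M[R]_(n, p)) :
  'M[R]_(#|I|, p) := rowsub (@enum_val _ (mem I)) X.

(* The classical left inverse of a matrix of full column rank; this is not the
   library's pinvmx. *)
Definition left_inv (R : realType) (n m : nat) (X : 'M[R]_(n, m)) :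
  'M[R]_(m, n) := invmx (X^T *m X) *m X^T.

(* R^n carries its product sigma-algebra as n.-tuple R; the linear algebra is
   done on column vectors. *)
Definition cvec (R : Type) (n : nat) (y : n.-tuple R) : 'cV[R]_n :=
  \col_i tnth y i.

Definition tvec (R : Type) (n : nat) (v : 'cV[R]_n) : n.-tuple R :=
  [tuple v i ord0 | i < n].

(* Q = N(mu, sigma^2 I_n): Q is the product of the univariate laws
   N(mu_i, sigma^2), tested on measurable rectangles. *)
Definition gaussian_law (R : realType) (n : nat) (mu : 'cV[R]_n) (sigma : R)
    (Q : probability (n.-tuple R) R) : Prop :=
  forall B : 'I_n -> set R, (forall i, measurable (B i)) ->
    fine (Q [set y | forall i, B i (tnth y i)]) =
    \prod_(i < n) fine (normal_prob (mu i ord0) sigma (B i)).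

Definition cprob d (T : measurableType d) (R : realType) (P : probability T R)
    (B E : set T) : R := fine (P (B `&` E)) / fine (P E).

(* k is a regular conditional distribution, given the statistic S, of the law
   Q( . | D):
     Q(B, S \in C | D) = \int_{S \in C} k(S(y), B) Q(dy | D);
   both sides are multiplied by Q(D). *)
Definition regular_cond_dist d d' (T : measurableType d)
    (Z : measurableType d') (R : realType) (Q : probability T R)
    (S : T -> Z) (D : set T) (k : R.-pker Z ~> T) : Prop :=
  forall (B : set T) (C : set Z), measurable B -> measurable C ->
    Q (B `&` (S @^-1` C `&` D)) =
    (\int[Q]_(y in S @^-1` C `&` D) k (S y) B)%E.

Definition lasso_obj (R : realType) (m p : nat) (X : 'M[R]_(m, p))
    (y : 'cV[R]_m) (lambda : R) (b : 'cV[R]_p) : R :=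
  2^-1 * (\sum_i (y - X *m b) i ord0 ^+ 2) + lambda * \sum_j `|b j ord0|.

Definition unique_argmin (R : realType) (T : eqType) (f : T -> R) (b : T) :
  Prop := forall b', b' != b -> f b < f b'.

Definition supp (R : realType) (p : nat) (b : 'cV[R]_p) : {set 'I_p} :=
  [set j | b j ord0 != 0]%SET.

Definition has_signs (R : realType) (p : nat) (M : {set 'I_p})
    (xi : 'cV[R]_#|M|) (b : 'cV[R]_p) : Prop :=
  forall k : 'I_#|M|, Num.sg (b (enum_val k) ord0) = xi k ord0.

(* The event A y <= b of the active constraints. *)
Definition active_event (R : realType) (n p : nat) (X : 'M[R]_(n, p))
    (I : {set 'I_n}) (lambda : R) (St : {set 'I_p}) (xi : 'cV[R]_#|St|) :
    set (n.-tuple R) :=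
  [set y | let X1 := rows I (cols St X) in
           let y1 := rows I (cvec y) in
           let Dxi := diag_mx xi^T in
           let H := invmx (X1^T *m X1) in
           forall k, (- Dxi *m H *m X1^T *m y1) k ord0 <=
                     (- lambda *: (Dxi *m H *m xi)) k ord0].

(* In the next definitions Gt is a subset of St. *)
Definition group_stat (R : realType) (n p : nat) (X : 'M[R]_(n, p))
    (St : {set 'I_p}) (xi : 'cV[R]_#|St|) (Gt : {set 'I_p})
    (y : n.-tuple R) : R :=
  \sum_(k < #|St| | enum_val k \in Gt)
    xi k ord0 * (left_inv (cols St X) *m cvec y) k ord0.

Definition nuisance_stat (R : realType) (n p : nat) (X : 'M[R]_(n, p))
    (St Gt : {set 'I_p}) (y : n.-tuple R) : #|St :\: Gt|.-tuple R :=
  tvec ((cols (St :\: Gt)%SET X)^T *m cvec y).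

(* k is meant to be a regular conditional distribution of Y given the nuisance
   statistic on the active event. *)
Definition group_pvalue (R : realType) (n p : nat) (X : 'M[R]_(n, p))
    (St : {set 'I_p}) (xi : 'cV[R]_#|St|) (G : {set 'I_p})
    (k : R.-pker #|St :\: (G :&: St)|.-tuple R ~> n.-tuple R)
    (y : n.-tuple R) : \bar R :=
  let Gt := (G :&: St)%SET in
  if (0 < #|Gt|)%N then
    k (nuisance_stat X St Gt y)
      [set y' | group_stat X xi Gt y' >= group_stat X xi Gt y]
  else 1%E.

(* Main.v *)
Require Import Defs.
From HB Require Import structures.
From mathcomp Require Import all_boot all_order all_algebra.
From mathcomp Require Import all_classical all_reals all_analysis.
From mathcomp Require Import measurable_realfun ring lra.

(* The data enter the statistic, the nuisance statistic and the active
   constraints only through the component of Y orthogonal to the residuals of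
   Y_1 on X_{1,St}, and the inactive constraints only through those residuals.
   These two components of a Gaussian vector are independent (a product of plane
   rotations turns the residual projection into a coordinate projection, and
   plane rotations preserve Gaussian product laws), so the inactive constraints
   can be dropped.  By screening and the null hypothesis the means of Y and Q
   differ by a combination of the nuisance columns, so the law of Y has a density
   with respect to Q that depends on y only through the nuisance statistic: the
   kernel K, which is a conditional law for Q, serves for the law of Y too, and
   conditionally on the nuisance statistic the survival function of the test
   statistic evaluated at itself is superuniform.  The selection event has strict
   active inequalities where A y <= b has weak ones; the difference is a union of
   hyperplanes, which is null. *)

Set Implicit Arguments.
Unset Strict Implicit.
Unset Printing Implicit Defensive.

Import Order.TTheory GRing.Theory Num.Theory.
Import numFieldNormedType.Exports.

Local Open Scope classical_set_scope.
Local Open Scope ring_scope.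

(** * Lebesgue measure and rotations of the plane *)

Section density.
Import HBNNSimple.

(** A Gaussian law is given here only by its values on rectangles. Every transport of it is
    therefore an equality of measures tested on rectangles, and orthogonal maps are assembled from
    rotations of two coordinates, where a rotated rectangle can be measured through the plane
    density. Turning a vector to a coordinate axis then serves three purposes: splitting off
    orthogonal components, showing that hyperplanes are null, and computing the density of a shifted
    law. Independence is indispensable because [K] is conditional on the active constraints alone,
    whereas the selection event contains the inactive ones too; their probability becomes a common
    factor of both sides of the claim. The kernel is tied to [Q] only through integrals, so the
    superuniformity that holds under each measure [K z] is carried to [Q] as an inequality over
    every measurable set of nuisance values. As an inequality between measures on the nuisance
    space, it can be integrated against the density. *)

Lemma ge0_integral_density (d : measure_display) (T : measurableType d)
    (R : realType) (mu nu : {measure set T -> \bar R}) (g : T -> R)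
    (D : set T) (f : T -> \bar R) :
  measurable_fun setT g -> (forall x, 0 <= g x) ->
  (forall A, measurable A -> nu A = (\int[mu]_(x in A) (g x)%:E)%E) ->
  measurable D -> measurable_fun D f -> (forall x, D x -> 0 <= f x)%E ->
  (\int[nu]_(x in D) f x = \int[mu]_(x in D) (f x * (g x)%:E))%E.
Proof.
move=> mg g0 nuE mD mf f0.
pose f_ := nnsfun_approx mD mf.
have cf x : D x -> ((f_ n x)%:E @[n --> \oo] --> f x).
  by move=> Dx; apply: cvg_nnsfun_approx => //.
have f_y x m n : (m <= n)%N -> f_ m x <= f_ n x.
  by move=> mn; exact/lefP/nd_nnsfun_approx.
transitivity (limn (fun n => \int[nu]_(x in D) (f_ n x)%:E)%E).
  rewrite -monotone_convergence//.
  - by apply: eq_integral => y /[!inE] yD; apply/esym/cvg_lim => //; exact: cf.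
  - by move=> n; exact/measurable_EFinP/measurable_funP.
  - by move=> n y _; rewrite lee_fin.
  - by move=> y _ m n mn; rewrite lee_fin; exact: f_y.
transitivity (limn (fun n => \int[mu]_(x in D) ((f_ n x)%:E * (g x)%:E))%E); last first.
  rewrite -monotone_convergence//.
  - apply: eq_integral => y /[!inE] yD; apply/cvg_lim => //.
    exact/cvgeZr/cf.
  - move=> n; apply: emeasurable_funM; last exact/measurable_EFinP/measurable_funTS.
    exact/measurable_EFinP/measurable_funP.
  - by move=> n y _; rewrite mule_ge0// lee_fin//.
  - by move=> y _ m n mn; rewrite lee_wpmul2r ?lee_fin//; exact: f_y.
congr (limn _); apply/funext => n.
have mfn r : measurable (f_ n @^-1` [set r]).
  by rewrite -[X in measurable X]setTI; exact: measurable_funP.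
under eq_integral do rewrite fimfunE -fsumEFin//.
rewrite ge0_integral_fsum//; last 2 first.
- by move=> r; exact/measurable_EFinP/measurable_funM.
- by move=> r x _; rewrite nnfun_muleindic_ge0.
under [RHS]eq_integral => x xD.
  rewrite fimfunE -fsumEFin// ge0_mule_fsuml; last first.
    by move=> r; rewrite nnfun_muleindic_ge0.
  over.
rewrite ge0_integral_fsum//; last 2 first.
- move=> r; apply: emeasurable_funM; last exact/measurable_EFinP/measurable_funTS.
  exact/measurable_EFinP/measurable_funM.
- by move=> r x _; apply: mule_ge0; [exact: nnfun_muleindic_ge0|rewrite lee_fin].
apply: eq_fsbigr => r; rewrite inE => -[t _ <-]{r}.
rewrite integralZl_indic_nnsfun// integral_indic// nuE//; last exact: measurableI.
rewrite setIC integral_mkcondr -ge0_integralZl//.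
- apply: eq_integral => x _; rewrite epatch_indic EFinM -muleA; congr (_ * _)%E.
  by rewrite muleC.
- apply/measurable_restrict => //.
  exact/measurable_EFinP/measurable_funTS.
- by move=> x _; apply: erestrict_ge0 => y _; rewrite lee_fin.
- by rewrite lee_fin.
Qed.

End density.

(** Lebesgue measure is the only measure giving half-open intervals their length, and its image
    under a translation does so too. *)
Lemma lebesgue_measure_translate (R : realType) (a : R) (A : set R) :
  measurable A ->
  lebesgue_measure ((fun x => x + a) @^-1` A : set R) = lebesgue_measure A.
Proof.
move=> mA.
pose t : measurableTypeR R -> measurableTypeR R := fun x => x + a.
have mt : measurable_fun setT t by exact: measurable_funD.
apply/esym; change (lebesgue_measure A = pushforward lebesgue_measure t A).
apply: lebesgue_measure_unique => // _ [[b c]] _ <-.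
transitivity (lebesgue_measure (`]b - a, c - a]%classic : set R)).
  rewrite !lebesgue_measure_itv/= !lte_fin ltrD2r -!EFinD.
  by rewrite opprD opprK addrACA addNr addr0.
congr lebesgue_measure; apply/seteqP.
by split => x/=; rewrite !in_itv/= ltrBlDr lerBrDr.
Qed.

Section plane.
Context {R : realType}.
Local Notation T := (measurableTypeR R).
Local Notation mu := (@lebesgue_measure R).

Definition preserves (phi : T * T -> T * T) := measurable_fun setT phi /\
  forall W, measurable W -> (mu \x mu)%E (phi @^-1` W) = (mu \x mu)%E W.

Lemma preserves_comp phi psi :
  preserves phi -> preserves psi -> preserves (phi \o psi).
Proof.
move=> [mphi Hphi] [mpsi Hpsi]; split; first exact: measurableT_comp.
move=> W mW; rewrite comp_preimage Hpsi ?Hphi//.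
by rewrite -[X in measurable X]setTI; exact: mphi.
Qed.

(** On the section at [x] the shear is the translation by [a * x]; translation invariance is then
    integrated over [x]. *)
Lemma preserves_shear2 (a : R) : preserves (fun z => (z.1, z.2 + a * z.1)).
Proof.
have mf : measurable_fun setT (fun z : T * T => (z.1, z.2 + a * z.1) : T * T).
  apply: measurable_fun_pair => //=; apply: measurable_funD => //=.
  exact: measurable_funM.
split => // W mW; rewrite /product_measure1; apply: eq_integral => x _ /=.
rewrite -(lebesgue_measure_translate (a * x) (measurable_xsection x mW)).
by congr (mu _); apply/seteqP; split => y /=; rewrite /xsection/= !inE.
Qed.

Lemma preserves_swap : preserves (fun z => (z.2, z.1)).
Proof.
have mf : measurable_fun setT (fun z : T * T => (z.2, z.1) : T * T).
  exact: measurable_fun_pair.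
split => // W mW.
pose m' := pushforward (mu \x mu)%E (fun z : T * T => (z.2, z.1) : T * T).
suff -> : (mu \x mu)%E W = m' W by [].
apply: product_measure_unique => // A B mA mB.
rewrite /m' /= /pushforward (_ : _ @^-1` _ = B `*` A); last first.
  by apply/seteqP; split => -[x y] /= [].
by rewrite product_measure1E// muleC.
Qed.

Lemma preserves_shear1 (a : R) : preserves (fun z => (z.1 + a * z.2, z.2)).
Proof.
exact: preserves_comp preserves_swap
  (preserves_comp (preserves_shear2 a) preserves_swap).
Qed.

(* A rotation is the product of three shears, with slopes [tan (t / 2)],
   [- sin t] and [tan (t / 2)]. *)
Lemma preserves_rotation (c s : R) : c ^+ 2 + s ^+ 2 = 1 -> s != 0 ->
  preserves (fun z => (c * z.1 + s * z.2, c * z.2 - s * z.1)).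
Proof.
move=> cs s0; pose u := (1 - c) / s.
have := preserves_comp (preserves_shear1 u)
  (preserves_comp (preserves_shear2 (- s)) (preserves_shear1 u)).
rewrite /comp/=; congr preserves; apply/funext => -[x y] /=.
have us : u * s = 1 - c by rewrite /u divfK.
(* The second half-angle formula, tan (t / 2) = sin t / (1 + cos t), in product form. *)
have uc : u * (1 + c) = s.
  apply: (mulfI s0); rewrite mulrA [s * u]mulrC us.
  have -> : s * s = c ^+ 2 + s ^+ 2 - c ^+ 2 by ring.
  by rewrite cs; ring.
congr pair.
  transitivity (x * (1 - u * s) + y * (u * (1 + (1 - u * s)))); first by ring.
  by rewrite us subKr uc; ring.
transitivity (y * (1 - u * s) - s * x); first by ring.
by rewrite us subKr; ring.
Qed.

Lemma preserves_integral phi (W : set (T * T)) (f : T * T -> \bar R) :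
  preserves phi -> measurable W -> measurable_fun W f ->
  (forall z, 0 <= f z)%E ->
  (\int[mu \x mu]_(z in phi @^-1` W) f (phi z) =
   \int[mu \x mu]_(z in W) f z)%E.
Proof.
move=> [mphi Hphi] mW mf f0.
transitivity (\int[pushforward (mu \x mu)%E phi]_(z in W) f z)%E.
  apply/esym; apply: ge0_integral_pushforward; [exact: mphi|exact: mW|exact: mf|].
  by move=> z _; exact: f0.
by apply: eq_measure_integral => A mA _; exact: Hphi.
Qed.

Lemma normal_prod_density (m1 m2 s : R) (W : set (T * T)) : measurable W ->
  (normal_prob m1 s \x normal_prob m2 s)%E W =
  (\int[mu \x mu]_(z in W) (normal_pdf m1 s z.1 * normal_pdf m2 s z.2)%:E)%E.
Proof.
move=> mW; rewrite integral_mkcond.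
have mpdf m : measurable_fun [set: T] (normal_pdf m s).
  exact: measurable_normal_pdf.
have mf : measurable_fun [set: T * T]
  (fun z : T * T => (normal_pdf m1 s z.1 * normal_pdf m2 s z.2)%:E).
  by apply/measurable_EFinP/measurable_funM; apply: measurableT_comp.
rewrite fubini_tonelli1; last 2 first.
- apply/(measurable_restrictT _ mW); exact: measurable_funTS.
- move=> z; apply: erestrict_ge0 => w _.
  by rewrite lee_fin mulr_ge0// normal_pdf_ge0.
rewrite /product_measure1.
rewrite (@ge0_integral_density _ _ _ mu _ (normal_pdf m1 s))//; last 2 first.
- by move=> x; exact: normal_pdf_ge0.
- apply: measurable_fun_xsection => //.
apply: eq_integral => x _ /=.
rewrite /normal_prob -ge0_integralZr; [|exact: measurable_xsection| | |].
- rewrite /fubini_F integral_mkcond; apply: eq_integral => y _.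
  rewrite /patch/= mem_xsection; case: ifP => // _.
  by rewrite -EFinM mulrC.
- exact/measurable_EFinP/measurable_funTS.
- by move=> y _; rewrite lee_fin normal_pdf_ge0.
- by rewrite lee_fin normal_pdf_ge0.
Qed.

(** The variances are equal, so the joint density depends only on the distance to the mean, which a
    rotation preserves while it moves the mean to its image. *)
Lemma normal_prod_rotation (m1 m2 sigma c s : R) (W : set (T * T)) :
  sigma != 0 -> c ^+ 2 + s ^+ 2 = 1 -> s != 0 -> measurable W ->
  (normal_prob m1 sigma \x normal_prob m2 sigma)%E
    ((fun z => (c * z.1 + s * z.2, c * z.2 - s * z.1)) @^-1` W) =
  (normal_prob (c * m1 + s * m2) sigma \x
   normal_prob (c * m2 - s * m1) sigma)%E W.
Proof.
move=> sigma0 cs s0 mW; have pr := preserves_rotation cs s0.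
apply: etrans; first apply: normal_prod_density.
  by rewrite -[X in measurable X]setTI; exact: pr.1.
apply: etrans; last exact/esym/normal_prod_density.
pose f (z : T * T) := (normal_pdf (c * m1 + s * m2) sigma z.1 *
  normal_pdf (c * m2 - s * m1) sigma z.2)%:E.
apply: etrans; last first.
  apply: (@preserves_integral _ W f pr mW).
    apply: measurable_funTS; apply/measurable_EFinP/measurable_funM;
    by apply: measurableT_comp => //; exact: measurable_normal_pdf.
  by move=> z; rewrite lee_fin mulr_ge0// normal_pdf_ge0.
apply: eq_integral => -[x y] _; rewrite /f /=.
rewrite !normal_pdfE// /normal_fun; congr _%:E.
rewrite mulrACA [in RHS]mulrACA -!expRD; congr (_ * expR _).
rewrite -!mulrDl -!opprD; congr (- _ * _).
transitivity ((c ^+ 2 + s ^+ 2) * ((x - m1) ^+ 2 + (y - m2) ^+ 2)); last by ring.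
by rewrite cs mul1r.
Qed.

(** Used coordinatewise to pass from the law of the noise to that of the response. *)
Lemma normal_prob_translate (m s a : R) (A : set R) : measurable A ->
  s != 0 -> normal_prob m s ((fun x => x + a) @^-1` A) = normal_prob (m + a) s A.
Proof.
move=> mA s0.
have mt : measurable_fun setT ((fun x => x + a) : T -> T).
  exact: measurable_funD.
rewrite /normal_prob.
transitivity (\int[pushforward mu ((fun x => (x + a)%R) : T -> T)]_(x in A)
  (normal_pdf (m + a) s x)%:E)%E; last first.
  by apply: eq_measure_integral => B mB _; exact: lebesgue_measure_translate.
apply: etrans; last first.
  apply/esym; apply: ge0_integral_pushforward; [exact: mt|exact: mA| |].
    by apply/measurable_EFinP/measurable_funTS; exact: measurable_normal_pdf.
  by move=> x _; rewrite lee_fin normal_pdf_ge0.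
apply: eq_integral => x _; rewrite [RHS]/= !normal_pdfE// /normal_fun.
have -> : x + a - (m + a) = x - m :> R by rewrite opprD addrACA subrr addr0.
by [].
Qed.

End plane.

(** * Gaussian vectors and orthogonal maps *)

Section tuples.
Context {d : measure_display} {T : measurableType d} {n : nat}.

Definition rect (B : 'I_n -> set T) : set (n.-tuple T) :=
  [set y | forall i, B i (tnth y i)].

Lemma rectE (B : 'I_n -> set T) :
  rect B = \bigcap_(i in [set: 'I_n]) ((@tnth n T)^~ i @^-1` B i).
Proof. by apply/seteqP; split => y /= H i; [move=> _|]; exact: H. Qed.

Lemma measurable_rect (B : 'I_n -> set T) :
  (forall i, measurable (B i)) -> measurable (rect B).
Proof.
move=> mB; rewrite rectE; apply: fin_bigcap_measurable => // i _.
by rewrite -[X in measurable X]setTI; exact: measurable_tnth.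
Qed.

Definition rects : set (set (n.-tuple T)) :=
  [set A | exists2 B, (forall i, measurable (B i)) & A = rect B].

(** A coordinate preimage is a rectangle with the whole space in the other slots. Rectangles, unlike
    these preimages, are closed under intersection, as uniqueness of measures requires. *)
Lemma measurable_tupleE : (measurable : set (set (n.-tuple T))) = <<s rects >>.
Proof.
apply/seteqP; split.
  apply: smallest_sub; first exact: smallest_sigma_algebra.
  move=> A; rewrite -bigcup_seq => -[i _ [B mB <-]].
  apply: sub_sigma_algebra; exists (fun k => if k == i then B else setT).
    by move=> k; case: ifP.
  apply/seteqP; split => y /=.
    by move=> [_ By] k; case: eqP => // ->.
  by move=> /(_ i); rewrite eqxx.
apply: smallest_sub; first exact: sigma_algebra_measurable.
by move=> _ [B mB ->]; exact: measurable_rect.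
Qed.

Lemma tuple_measure_unique (R : realType)
    (m1 m2 : {measure set (n.-tuple T) -> \bar R}) :
  (m1 setT < +oo)%E ->
  (forall B, (forall i, measurable (B i)) -> m1 (rect B) = m2 (rect B)) ->
  forall A, measurable A -> m1 A = m2 A.
Proof.
move=> m1T m12; apply: (measure_unique rects (fun=> setT)) => //.
- exact: measurable_tupleE.
- move=> _ _ [B mB ->] [C mC ->]; exists (fun i => B i `&` C i).
    by move=> i; exact: measurableI.
  apply/seteqP; split => y /=; last by move=> H; split => i; have [] := H i.
  by move=> [H1 H2] i; split; [exact: H1|exact: H2].
- by move=> _; exists (fun=> setT) => //; apply/seteqP; split.
- by rewrite bigcup_const.
- by move=> _ [B mB ->]; exact: m12.
Qed.

End tuples.

Section image.
Context {d d' : measure_display} {T : measurableType d} {T' : measurableType d'}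
  {R : realType}.

(** The pushforward bundled as a measure, with the measurability of [f] as an explicit argument, so
    that it can be passed where a measure is expected. *)
Definition image_measure (m : {measure set T -> \bar R}) (f : T -> T')
    (mf : measurable_fun setT f) : {measure set T' -> \bar R} :=
  measure_function_pushforward__canonical__measure_function_Measure m mf.

Lemma image_measureE m f mf A : @image_measure m f mf A = m (f @^-1` A).
Proof. by []. Qed.

End image.

Section gauss.
Context {R : realType}.

Lemma cvecK n : cancel (@cvec R n) (@tvec R n).
Proof. by move=> y; apply: eq_from_tnth => i; rewrite tnth_mktuple mxE. Qed.

Lemma tvecK n : cancel (@tvec R n) (@cvec R n).
Proof. by move=> y; apply/colP => i; rewrite mxE tnth_mktuple. Qed.

Definition lmap m n (M : 'M[R]_(m, n)) (y : n.-tuple R) : m.-tuple R :=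
  tvec (M *m cvec y).

Lemma cvec_lmap m n (M : 'M[R]_(m, n)) y : cvec (lmap M y) = M *m cvec y.
Proof. exact: tvecK. Qed.

Lemma tnth_lmap m n (M : 'M[R]_(m, n)) y i :
  tnth (lmap M y) i = \sum_j M i j * tnth y j.
Proof.
by rewrite tnth_mktuple mxE; apply: eq_bigr => j _; rewrite mxE.
Qed.

Lemma lmapM m n p (M : 'M[R]_(m, n)) (N : 'M[R]_(n, p)) y :
  lmap M (lmap N y) = lmap (M *m N) y.
Proof. by rewrite /lmap tvecK mulmxA. Qed.

Lemma lmap1 n (y : n.-tuple R) : lmap 1%:M y = y.
Proof. by rewrite /lmap mul1mx cvecK. Qed.

Lemma measurable_coord_sum n (a : 'I_n -> R) :
  measurable_fun setT (fun y : n.-tuple R => \sum_j a j * tnth y j).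
Proof.
apply: measurable_sum => j; apply: measurable_funM => //.
exact: measurable_tnth.
Qed.

Lemma measurable_lmap m n (M : 'M[R]_(m, n)) : measurable_fun setT (lmap M).
Proof.
apply/measurable_fun_tnthP => i.
rewrite (_ : _ \o _ = (fun y => \sum_j M i j * tnth y j)).
  exact: measurable_coord_sum.
by apply/funext => y /=; rewrite tnth_lmap.
Qed.

(** Here [Q] is any extended-real set function, so that images of measures under linear maps qualify
    without being repackaged as probabilities. *)
Definition gauss n (m : 'cV[R]_n) (s : R) (Q : set (n.-tuple R) -> \bar R) :=
  forall B : 'I_n -> set R, (forall i, measurable (B i)) ->
    Q (rect B) = (\prod_(i < n) fine (normal_prob (m i ord0) s (B i)))%:E.

Lemma gaussian_law_gauss n (m : 'cV[R]_n) s (Q : probability (n.-tuple R) R) :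
  gaussian_law m s Q -> gauss m s Q.
Proof.
move=> H B mB; rewrite -H// fineK//; exact: fin_num_measure (measurable_rect mB).
Qed.

Lemma gaussT n (m : 'cV[R]_n) s (Q : set (n.-tuple R) -> \bar R) :
  gauss m s Q -> Q setT = 1%E.
Proof.
move=> H; rewrite (_ : setT = rect (fun=> setT)); last by apply/seteqP; split.
by rewrite H// big1// => i _; rewrite probability_setT.
Qed.

(** A rotated rectangle is not a rectangle, so the coordinates [i] and [j] must jointly range over
    any measurable [W]. Both sides are measures in [W] and agree on rectangles. *)
Lemma gauss_pair n (m : 'cV[R]_n) s (Q : {measure set (n.-tuple R) -> \bar R})
    (i j : 'I_n) (B : 'I_n -> set R) (W : set (measurableTypeR R * measurableTypeR R)) :
  gauss m s Q -> i != j -> (forall k, measurable (B k)) -> measurable W ->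
  Q [set y | W (tnth y i, tnth y j) /\
             forall k, k != i -> k != j -> B k (tnth y k)] =
  ((\prod_(k | (k != i) && (k != j)) fine (normal_prob (m k ord0) s (B k)))%:E *
   (normal_prob (m i ord0) s \x normal_prob (m j ord0) s) W)%E.
Proof.
move=> gQ ij mB mW.
pose N k := normal_prob (m k ord0) s.
pose D : set (n.-tuple R) := rect (fun k => if (k != i) && (k != j) then B k else setT).
have mD : measurable D by apply: measurable_rect => k; case: ifP.
have mf : measurable_fun setT
    (fun y : n.-tuple R => (tnth y i, tnth y j) : measurableTypeR R * measurableTypeR R).
  by apply: measurable_fun_pair => /=; exact: measurable_tnth.
pose c := \prod_(k | (k != i) && (k != j)) fine (N k (B k)).
have c0 : 0 <= c by apply: prodr_ge0 => k _; rewrite fine_ge0.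
pose nu := image_measure (mrestr Q mD) mf.
transitivity (nu W).
  congr (Q _); apply/seteqP; split => y /= [Wy Hy]; split => // k.
    by case: ifP => // /andP[]; exact: Hy.
  by move=> ki kj; have := Hy k; rewrite ki kj.
apply/esym; change (mscale (NngNum c0) (N i \x N j)%E W = nu W).
apply: (measure_unique
  [set C | exists A1, measurable A1 /\ exists A2, measurable A2 /\ C = A1 `*` A2]
  (fun=> setT)) => //.
- rewrite measurable_prod_measurableType; congr (<<s _ >>).
  apply/seteqP; split => [_ [A mA [A' mA' <-]]|_ [A [mA [A' [mA' ->]]]]].
    by exists A; split => //; exists A'.
  by exists A => //; exists A'.
- move=> _ _ [A [mA [A' [mA' ->]]]] [C [mC [C' [mC' ->]]]].
  rewrite -setXI; exists (A `&` C); split; first exact: measurableI.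
  by exists (A' `&` C'); split => //; exact: measurableI.
- by move=> _; exists setT; split => //; exists setT; split => //; rewrite setXTT.
- by rewrite bigcup_const.
- move=> _ [A [mA [A' [mA' ->]]]].
  pose B' k := if k == i then A else if k == j then A' else B k.
  transitivity (Q (rect B')); last first.
    congr (Q _); apply/seteqP; split => y /=.
      move=> H; split; first split.
      - by have := H i; rewrite /B' eqxx.
      - by have := H j; rewrite /B' eqxx eq_sym (negbTE ij).
      - by move=> k; have := H k; rewrite /B'; case: (k == i); case: (k == j).
    move=> [[Ay A'y] H] k; rewrite /B'; have := H k.
    by case: (eqVneq k i) => [->|_] //=; case: (eqVneq k j) => [->|_] //=; exact.
  rewrite gQ; last by move=> k; rewrite /B'; case: ifP => // _; case: ifP.
  change (c%:E * (N i \x N j)%E (A `*` A') =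
    (\prod_k fine (N k (B' k)))%:E)%E.
  rewrite product_measure1E//.
  rewrite (bigD1 i)//= (bigD1 j)/=; last by rewrite eq_sym.
  rewrite /B' eqxx eq_sym (negbTE ij) eqxx.
  rewrite (eq_bigr (fun k => fine (N k (B k)))); last first.
    by move=> k /andP[/negbTE -> /negbTE ->].
  have [a aE] : exists a, N i A = a%:E.
    by exists (fine (N i A)); rewrite fineK// fin_num_measure.
  have [a' a'E] : exists a', N j A' = a'%:E.
    by exists (fine (N j A')); rewrite fineK// fin_num_measure.
  rewrite -/(N i A) -/(N j A') aE a'E -!EFinM/= /c.
  by rewrite mulrA mulrC.
- move=> _; change (c%:E * (N i \x N j)%E setT < +oo)%E.
  have NT k : N k setT = 1%E by exact: probability_setT.
  rewrite -setXTT product_measure1E//.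
  change (c%:E * (N i setT * N j setT) < +oo)%E.
  by rewrite !NT !mule1 ltry.
Qed.

Lemma gauss_coord n (m : 'cV[R]_n) s (Q : set (n.-tuple R) -> \bar R)
    (i : 'I_n) (B : 'I_n -> set R) (W : set R) :
  gauss m s Q -> (forall k, measurable (B k)) -> measurable W ->
  Q [set y | W (tnth y i) /\ forall k, k != i -> B k (tnth y k)] =
  ((\prod_(k | k != i) fine (normal_prob (m k ord0) s (B k)))%:E *
   normal_prob (m i ord0) s W)%E.
Proof.
move=> gQ mB mW; pose B' k := if k == i then W else B k.
transitivity (Q (rect B')).
  congr (Q _); apply/seteqP; split => y /=.
    move=> [Wy H] k; rewrite /B'; have := H k.
    by case: (eqVneq k i) => [->|_] //=; exact.
  move=> H; split; first by have := H i; rewrite /B' eqxx.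
  by move=> k; have := H k; rewrite /B'; case: (k == i).
rewrite gQ; last by move=> k; rewrite /B'; case: ifP.
rewrite (bigD1 i)//= /B' eqxx.
rewrite (eq_bigr (fun k => fine (normal_prob (m k ord0) s (B k)))); last first.
  by move=> k /negbTE ->.
by rewrite EFinM fineK ?fin_num_measure// muleC.
Qed.

Definition givens n (i j : 'I_n) (c s : R) : 'M[R]_n :=
  \matrix_(k, l) if k == i then c * (l == i)%:R + s * (l == j)%:R
                 else if k == j then c * (l == j)%:R - s * (l == i)%:R
                 else (k == l)%:R.

Lemma givensE n p (i j : 'I_n) c s (A : 'M[R]_(n, p)) k l :
  (givens i j c s *m A) k l =
    if k == i then c * A i l + s * A j l
    else if k == j then c * A j l - s * A i l else A k l.
Proof.
have sum1 i0 : \sum_j0 (j0 == i0)%:R * A j0 l = A i0 l.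
  rewrite (bigD1 i0)//= eqxx mul1r big1 ?addr0// => j0 /negbTE ->.
  by rewrite mul0r.
rewrite mxE; case: (eqVneq k i) => [->|ki].
  rewrite -!sum1 !mulr_sumr -big_split/=; apply: eq_bigr => q _.
  by rewrite mxE eqxx; ring.
case: (eqVneq k j) => [kj|kj].
  rewrite -!sum1 !mulr_sumr -sumrB/=; apply: eq_bigr => q _.
  by rewrite mxE (negbTE ki) kj eqxx; ring.
rewrite -sum1; apply: eq_bigr => q _.
by rewrite mxE (negbTE ki) (negbTE kj) eq_sym.
Qed.

Lemma givens_orth n (i j : 'I_n) c s : i != j -> c ^+ 2 + s ^+ 2 = 1 ->
  (givens i j c s)^T *m givens i j c s = 1%:M.
Proof.
move=> ij cs.
have -> : (givens i j c s)^T = givens i j c (- s).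
  apply/matrixP => k l; rewrite !mxE [l == k]eq_sym.
  (* These six facts record which of the five index equalities can hold together; the claim is then
     a finite Boolean check. *)
  have ab : ~~ ((k == i) && (k == j)).
    by apply/negP => /andP[/eqP-> ij0]; rewrite ij0 in ij.
  have ab' : ~~ ((l == i) && (l == j)).
    by apply/negP => /andP[/eqP-> ij0]; rewrite ij0 in ij.
  have ka : (k == i) ==> ((k == l) == (l == i)).
    by apply/implyP => /eqP ->; rewrite [i == l]eq_sym.
  have kb : (k == j) ==> ((k == l) == (l == j)).
    by apply/implyP => /eqP ->; rewrite [j == l]eq_sym.
  have la : (l == i) ==> ((k == l) == (k == i)) by apply/implyP => /eqP ->.
  have lb : (l == j) ==> ((k == l) == (k == j)) by apply/implyP => /eqP ->.
  move: ab ab' ka kb la lb.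
  case: (k == i); case: (k == j); case: (l == i); case: (l == j); case: (k == l);
    by move=> //= *; rewrite ?mulr0 ?mulr1 ?addr0 ?add0r ?subr0 ?opprK ?sub0r ?oppr0.
apply/matrixP => k l; rewrite givensE !mxE !eqxx [j == i]eq_sym (negbTE ij).
case: (eqVneq k i) => [->|ki].
  transitivity ((c ^+ 2 + s ^+ 2) * (l == i)%:R); first by ring.
  by rewrite cs mul1r eq_sym.
case: (eqVneq k j) => [->|kj] //.
transitivity ((c ^+ 2 + s ^+ 2) * (l == j)%:R); first by ring.
by rewrite cs mul1r eq_sym.
Qed.

(** Orthogonality is bundled with the transport of Gaussian laws. The class contains the rotations
    of two coordinates and is closed under products, which suffices for the constructions below. *)
Definition gauss_orth n (O : 'M[R]_n) := O^T *m O = 1%:M /\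
  forall (m : 'cV[R]_n) s (Q : {measure set (n.-tuple R) -> \bar R}),
    s != 0 -> gauss m s Q ->
    gauss (O *m m) s (image_measure Q (measurable_lmap O)).

Lemma gauss_orth1 n : gauss_orth (1%:M : 'M[R]_n).
Proof.
split; first by rewrite mulmx1 trmx1.
move=> m s Q s0 gQ B mB; rewrite mul1mx -gQ//.
by congr (Q _); apply/seteqP; split => y; rewrite /preimage/= lmap1.
Qed.

Lemma gauss_orthM n (O O' : 'M[R]_n) :
  gauss_orth O -> gauss_orth O' -> gauss_orth (O *m O').
Proof.
move=> [OO HO] [OO' HO']; split.
  by rewrite trmx_mul mulmxA -[_ *m _ *m O]mulmxA OO mulmx1.
move=> m s Q s0 gQ B mB.
have := HO _ _ _ s0 (HO' _ _ _ s0 gQ) B mB; rewrite mulmxA => <-.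
by congr (Q _); apply/seteqP; split => y; rewrite /preimage/= lmapM.
Qed.

(** Only the coordinates [i] and [j] change: the preimage of a rectangle is a rectangle in the
    others and a rotated rectangle in the plane of these two, to which [gauss_pair] applies. *)
Lemma gauss_orth_givens n (i j : 'I_n) c s : i != j -> c ^+ 2 + s ^+ 2 = 1 ->
  s != 0 -> gauss_orth (givens i j c s).
Proof.
move=> ij cs s0; split; first exact: givens_orth.
move=> m sigma Q sigma0 gQ B mB.
have ji : (j == i) = false by rewrite eq_sym (negbTE ij).
pose rot (z : measurableTypeR R * measurableTypeR R) :
  measurableTypeR R * measurableTypeR R := (c * z.1 + s * z.2, c * z.2 - s * z.1).
have mBB : measurable (B i `*` B j : set (measurableTypeR R * measurableTypeR R)).
  by apply: measurableX; exact: mB.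
have mW : measurable (rot @^-1` (B i `*` B j)).
  rewrite -[X in measurable X]setTI; apply: (preserves_rotation cs s0).1 => //.
have := gauss_pair gQ ij mB mW.
have -> : (normal_prob (m i ord0) sigma \x normal_prob (m j ord0) sigma)%E
    (rot @^-1` (B i `*` B j)) =
    (normal_prob (c * m i ord0 + s * m j ord0) sigma (B i) *
     normal_prob (c * m j ord0 - s * m i ord0) sigma (B j))%E.
  apply: etrans; first exact: normal_prod_rotation.
  by apply: product_measure1E; exact: mB.
move=> E; rewrite image_measureE.
transitivity (Q [set y | (rot @^-1` (B i `*` B j)) (tnth y i, tnth y j) /\
             forall k, k != i -> k != j -> B k (tnth y k)]).
  congr (Q _); apply/seteqP.
  have tE (y : n.-tuple R) k : tnth (lmap (givens i j c s) y) k =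
      if k == i then c * tnth y i + s * tnth y j
      else if k == j then c * tnth y j - s * tnth y i else tnth y k.
    by rewrite /lmap tnth_mktuple givensE !mxE.
  split => y /=.
    move=> H; split; first split => /=.
    - by have := H i; rewrite tE eqxx.
    - by have := H j; rewrite tE ji eqxx.
    - by move=> k ki kj; have := H k; rewrite tE (negbTE ki) (negbTE kj).
  move=> [[/= Hi Hj] H] k; rewrite tE.
  case: (eqVneq k i) => [->|ki] //; case: (eqVneq k j) => [->|kj] //.
  exact: H.
rewrite E [in RHS](bigD1 i)//= [in RHS](bigD1 j)/=; last by rewrite eq_sym.
rewrite !givensE eqxx ji eqxx.
rewrite [in RHS](eq_bigr (fun k => fine (normal_prob (m k ord0) sigma (B k)))); last first.
  by move=> k /andP[/negbTE ki /negbTE kj]; rewrite givensE ki kj.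
rewrite mulrA [in RHS]mulrC EFinM; congr (_ * _)%E.
by rewrite EFinM !fineK ?fin_num_measure//; exact: mB.
Qed.

(** Givens elimination: the entries after [k] are cleared one at a time by rotating the plane of [k]
    and [j], which fixes the earlier basis vectors and collects the length in entry [k]. *)
Lemma gauss_orth_clear n (k : 'I_n) (v : 'cV[R]_n) (l : nat) :
  exists O : 'M[R]_n, [/\ gauss_orth O,
    forall i : 'I_n, (i < k)%N -> O *m delta_mx i ord0 = delta_mx i ord0 :> 'cV_n &
    forall i : 'I_n, (k < i < l)%N -> (O *m v) i ord0 = 0].
Proof.
elim: l => [|l [ O [gO Ofix Ov]]].
  exists 1%:M; split.
  - exact: gauss_orth1.
  - by move=> i _; rewrite mul1mx.
  - by move=> i; rewrite ltn0 andbF.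
have [/andP[kl ln]|] := boolP ((k < l < n)%N); last first.
  move=> H; exists O; split => // i /andP[ki il]; apply: Ov; rewrite ki/=.
  move: il; rewrite ltnS leq_eqVlt => /orP[/eqP il|//].
  by move: H; rewrite -il ki ltn_ord.
pose j := Ordinal ln; pose w := O *m v.
(* A rotation of sine zero is outside [gauss_orth_givens], so an entry that already vanishes is left
   alone. *)
have [wj|wj] := eqVneq (w j ord0) 0.
  exists O; split => // i /andP[ki].
  rewrite ltnS leq_eqVlt => /orP[/eqP il|il]; last by apply: Ov; rewrite ki.
  by rewrite (_ : i = j)//; exact: val_inj.
pose r2 := w k ord0 ^+ 2 + w j ord0 ^+ 2.
have r2_gt0 : 0 < r2 by rewrite ltr_wpDl ?sqr_ge0// exprn_even_gt0.
pose r := Num.sqrt r2.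
have r0 : r != 0 by rewrite gt_eqF// sqrtr_gt0.
have rr : r ^+ 2 = r2 by rewrite sqr_sqrtr// ltW.
have kj : k != j by rewrite neq_ltn kl.
exists (givens k j (w k ord0 / r) (w j ord0 / r) *m O); split.
- apply: gauss_orthM; last exact: (gO).
  apply: gauss_orth_givens; first exact: (kj).
    by rewrite !expr_div_n -mulrDl rr divff// gt_eqF.
  by rewrite mulf_neq0// invr_eq0.
- move=> i ik; rewrite -mulmxA Ofix//; apply/colP => q.
  have ki : (k == i) = false by rewrite eq_sym; apply/negbTE; rewrite neq_ltn ik.
  have ji : (j == i) = false.
    by rewrite eq_sym; apply/negbTE; rewrite neq_ltn (ltn_trans ik kl).
  rewrite givensE !mxE ki ji /= !mulr0 addr0 subr0.
  by case: eqVneq => [->|_]; [rewrite ki|case: eqVneq => [->|_] //; rewrite ji].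
- move=> i /andP[ki]; rewrite -mulmxA -/w givensE.
  rewrite (_ : (i == k) = false); last by apply/negbTE; rewrite neq_ltn ki orbT.
  case: eqVneq => [_ _|ij]; first by field.
  rewrite ltnS leq_eqVlt => /orP[/eqP il|il]; last by apply: Ov; rewrite ki.
  by case/eqP: ij; exact: val_inj.
Qed.

Lemma gauss_orth_isometry n p (O : 'M[R]_n) (u v : 'M[R]_(n, p)) :
  gauss_orth O -> (O *m u)^T *m (O *m v) = u^T *m v.
Proof.
by move=> [OO _]; rewrite trmx_mul -mulmxA (mulmxA O^T) OO mul1mx.
Qed.

Lemma gauss_orthTr n (O : 'M[R]_n) : gauss_orth O -> O *m O^T = 1%:M.
Proof. by move=> [/mulmx1C]. Qed.

Lemma col_norm_eq0 n (v : 'cV[R]_n) : v^T *m v = 0 -> v = 0.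
Proof.
move=> /matrixP /(_ ord0 ord0); rewrite !mxE => /eqP.
rewrite psumr_eq0; last by move=> i _; rewrite mxE -expr2 sqr_ge0.
move=> /allP H; apply/colP => i; have := H i (mem_index_enum _).
by rewrite mxE -expr2 sqrf_eq0 => /eqP ->; rewrite mxE.
Qed.

(** Elimination clears the entries after [k]; those before stay zero because [O] fixes the
    corresponding basis vectors and preserves inner products. *)
Lemma gauss_orth_to_axis n (k : 'I_n) (v : 'cV[R]_n) : v != 0 ->
  (forall i : 'I_n, (i < k)%N -> v i ord0 = 0) ->
  exists O : 'M[R]_n, exists t : R, [/\ gauss_orth O, t != 0,
    forall i : 'I_n, (i < k)%N -> O *m delta_mx i ord0 = delta_mx i ord0 :> 'cV_n &
    O *m v = t *: delta_mx k ord0].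
Proof.
move=> v0 vk; have [ O [gO Ofix Ov]] := gauss_orth_clear k v n.
exists O, ((O *m v) k ord0).
have E : O *m v = (O *m v) k ord0 *: delta_mx k ord0.
  apply/colP => i; rewrite [RHS]mxE [X in _ = _ * X]mxE eqxx andbT.
  case: (ltngtP i k) => [ik|ki|/val_inj ->]; last by rewrite eqxx mulr1.
    rewrite (_ : (i == k) = false); last by apply/negbTE; rewrite neq_ltn ik.
    rewrite mulr0.
    have := gauss_orth_isometry (delta_mx i ord0) v gO.
    rewrite Ofix// trmx_delta -!rowE => /matrixP /(_ ord0 ord0).
    by rewrite !mxE vk// => <-; rewrite mxE.
  rewrite (_ : (i == k) = false); last by apply/negbTE; rewrite neq_ltn ki orbT.
  by rewrite mulr0 Ov// ki ltn_ord.
split => //.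
apply: contra_neq v0 => t0; apply: col_norm_eq0.
by rewrite -(gauss_orth_isometry _ _ gO) E t0 scale0r trmx0 mul0mx.
Qed.

End gauss.

(** The restricted measure has the indicator of [D] as density. *)
Lemma ge0_integral_mrestr (d : measure_display) (T : measurableType d)
    (R : realType) (mu : {measure set T -> \bar R}) (D E : set T)
    (mD : measurable D) (f : T -> \bar R) :
  measurable E -> measurable_fun E f -> (forall x, E x -> 0 <= f x)%E ->
  (\int[mrestr mu mD]_(x in E) f x = \int[mu]_(x in E `&` D) f x)%E.
Proof.
move=> mE mf f0.
rewrite (@ge0_integral_density _ _ _ mu (mrestr mu mD) (\1_D : T -> R))//.
  rewrite [RHS]integral_mkcondr.
  by apply: eq_integral => x _; rewrite epatch_indic.
move=> A mA; rewrite integral_indic//.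
by rewrite setIC.
Qed.

Section mdensity.
Context {d : measure_display} {T : measurableType d} {R : realType}.
Variables (mu : {measure set T -> \bar R}) (g : T -> \bar R).
Hypotheses (mg : measurable_fun setT g) (g0 : forall x, (0 <= g x)%E).

(** The proofs that [g] is measurable and nonnegative are arguments, so that the measure structure
    can be attached to the term itself. *)
Definition mdensity of measurable_fun setT g & (forall x, (0 <= g x)%E) :=
  fun A : set T => (\int[mu]_(x in A) g x)%E.

Let mdensity0 : mdensity mg g0 set0 = 0%E.
Proof. exact: integral_set0. Qed.

Let mdensity_ge0 A : (0 <= mdensity mg g0 A)%E.
Proof. exact: integral_ge0. Qed.

Let mdensity_sigma_additive : semi_sigma_additive (mdensity mg g0).
Proof.
move=> A mA tA mUA; rewrite /mdensity ge0_integral_bigcup//; last first.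
  exact: measurable_funTS.
apply: is_cvg_ereal_nneg_natsum_cond => n _ _; exact: integral_ge0.
Qed.

HB.instance Definition _ := isMeasure.Build _ _ _
  (mdensity mg g0) mdensity0 mdensity_ge0 mdensity_sigma_additive.

End mdensity.

(** * Independence, null hyperplanes and shifts of Gaussian laws *)

Section gauss.
Context {R : realType}.

(** Diagonalization of a projection, by induction on the number [k] of basis vectors fixed by the
    conjugate. A nonzero column of index at least [k] lies in the range, hence is fixed, and is
    orthogonal to the first [k] basis vectors; turning it to axis [k] gains one more. If there is
    none, the conjugate is [pid_mx k]. *)
Lemma gauss_orth_proj n (Pm : 'M[R]_n) : Pm^T = Pm -> Pm *m Pm = Pm ->
  exists O : 'M[R]_n, exists k, gauss_orth O /\ O *m Pm *m O^T = pid_mx k.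
Proof.
move=> PT PP.
suff H k : (exists O : 'M[R]_n, exists k, gauss_orth O /\ O *m Pm *m O^T = pid_mx k) \/
    exists O : 'M[R]_n, gauss_orth O /\ forall i : 'I_n, (i < k)%N ->
      O *m Pm *m O^T *m delta_mx i ord0 = delta_mx i ord0 :> 'cV_n.
  have [//|[ O [gO HO]]] := H n; exists O, n; split => //.
  rewrite pid_mx_1; apply/matrixP => i j.
  have /matrixP /(_ i ord0) := HO j (ltn_ord j).
  by rewrite -colE !mxE eqxx andbT.
elim: k => [|k [?|[ O [gO HO]]]]; [|by left|].
  by right; exists 1%:M; split; first exact: gauss_orth1.
have OO := gO.1.
have [P' P'E] : exists P', P' = O *m Pm *m O^T by eexists.
rewrite -P'E in HO.
have P'T : P'^T = P' by rewrite P'E !trmx_mul trmxK PT mulmxA.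
have P'P' : P' *m P' = P'.
  rewrite P'E !mulmxA -[ O *m Pm *m O^T *m O]mulmxA OO mulmx1.
  by rewrite -[ O *m Pm *m Pm]mulmxA PP.
have [nk|kn] := leqP n k.
  right; exists O; split => // i _; rewrite -P'E; apply: HO.
  exact: leq_trans (ltn_ord i) nk.
have [/existsP[l /andP[kl vn0]]|/existsPn Hl] :=
    boolP [exists l : 'I_n, (k <= l)%N && (P' *m delta_mx l ord0 != 0 :> 'cV_n)];
    last first.
  left; exists O, k; split => //; apply/matrixP => i l.
  rewrite -P'E [RHS]mxE.
  have -> : P' i l = (P' *m delta_mx l ord0 : 'cV_n) i ord0 by rewrite -colE mxE.
  have [lk|kl] := ltnP l k.
    rewrite HO// mxE eqxx andbT -val_eqE /=.
    by case: (eqVneq (val i) (val l)) => [->|]; rewrite ?lk.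
  have /nandP[/negP//|/negbNE/eqP ->] := Hl l; rewrite mxE.
  by case: (eqVneq (i : nat) l) => [->|]//=; rewrite ltnNge kl.
right; pose j := Ordinal kn; set v : 'cV_n := P' *m delta_mx l ord0 in vn0.
have P'v : P' *m v = v by rewrite /v mulmxA P'P'.
have vj (i : 'I_n) : (i < j)%N -> v i ord0 = 0.
  move=> ij; rewrite /v -colE mxE -P'T mxE.
  have /matrixP /(_ l ord0) := HO i ij; rewrite -colE !mxE eqxx andbT => ->.
  rewrite (_ : (l == i) = false)//; apply/negbTE; rewrite neq_ltn.
  by rewrite (leq_trans ij kl) orbT.
have [ O' [t [gO' t0 O'fix O'v]]] := gauss_orth_to_axis vn0 vj.
exists (O' *m O); split; first exact: gauss_orthM.
have -> : O' *m O *m Pm *m (O' *m O)^T = O' *m P' *m O'^T.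
  by rewrite trmx_mul P'E !mulmxA.
move=> i; rewrite ltnS leq_eqVlt => /orP[/eqP ik|ik].
  have -> : i = j by exact: val_inj.
  have -> : delta_mx j ord0 = t^-1 *: (O' *m v) :> 'cV_n.
    by rewrite O'v scalerA mulVf// scale1r.
  by rewrite -scalemxAr -!mulmxA (mulmxA O'^T) gO'.1 mul1mx P'v.
rewrite -{1}(O'fix i ik) -!mulmxA (mulmxA O'^T) gO'.1 mul1mx.
by rewrite HO// O'fix.
Qed.

Lemma tnth_lmap_pid n k (y : n.-tuple R) (i : 'I_n) :
  tnth (lmap (pid_mx k) y) i = if (i < k)%N then tnth y i else 0.
Proof.
rewrite tnth_lmap (bigD1 i)//= big1 ?addr0.
  by rewrite mxE eqxx/=; case: ifP => _; rewrite ?mul1r ?mul0r.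
by move=> j ji; rewrite mxE eq_sym (negbTE (ji : val j != val i)) mul0r.
Qed.

Lemma tnth_lmap_copid n k (y : n.-tuple R) (i : 'I_n) :
  tnth (lmap (copid_mx k) y) i = if (i < k)%N then 0 else tnth y i.
Proof.
rewrite /lmap /copid_mx mulmxBl mul1mx tnth_mktuple mxE [X in _ + X]mxE.
have := tnth_lmap_pid k y i; rewrite tnth_mktuple => ->; rewrite mxE.
by case: ifP => _; rewrite ?subrr ?subr0.
Qed.

(** Rectangles come first, then arbitrary [A], then arbitrary [B]; each extension is uniqueness of
    measures with the other set fixed. *)
Lemma gauss_block n (m : 'cV[R]_n) s (Q : {measure set (n.-tuple R) -> \bar R}) k
    (A B : set (n.-tuple R)) :
  gauss m s Q -> measurable A -> measurable B ->
  (Q (lmap (pid_mx k) @^-1` A `&` lmap (copid_mx k) @^-1` B) =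
  Q (lmap (pid_mx k) @^-1` A) * Q (lmap (copid_mx k) @^-1` B))%E.
Proof.
move=> gQ mA mB.
pose f : n.-tuple R -> n.-tuple R := lmap (pid_mx k).
pose g : n.-tuple R -> n.-tuple R := lmap (copid_mx k).
have mf : measurable_fun setT f by exact: measurable_lmap.
have mg : measurable_fun setT g by exact: measurable_lmap.
have mfA C : measurable C -> measurable (f @^-1` C).
  by move=> mC; rewrite -[X in measurable X]setTI; exact: mf.
have mgA C : measurable C -> measurable (g @^-1` C).
  by move=> mC; rewrite -[X in measurable X]setTI; exact: mg.
have finQ C : measurable C -> Q C \is a fin_num.
  move=> mC; rewrite ge0_fin_numE//; apply: (@le_lt_trans _ _ (Q setT)).
    by apply: le_measure; rewrite ?inE.
  by rewrite (gaussT gQ) ltry.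
rewrite -/f -/g.
pose N i := normal_prob (m i ord0) s.
have N0 i : N i set0 = 0%E by exact: measure0.
have Ncst i (a : R) (C : set R) : fine (N i [set _ | C a]) = (`[< C a >])%:R.
  have [Ca|nCa] := asboolP (C a).
    rewrite (_ : [set _ | C a] = setT); last by apply/seteqP; split.
    by rewrite /N probability_setT.
  rewrite (_ : [set _ | C a] = set0); last by apply/seteqP; split.
  by rewrite N0.
have mcst (a : R) (C : set R) : measurable ([set _ | C a] : set R).
  have [Ca|nCa] := pselect (C a).
    by rewrite (_ : [set _ | C a] = setT)//; apply/seteqP; split.
  by rewrite (_ : [set _ | C a] = set0)//; apply/seteqP; split.
have step1 A1 A2 : (forall i, measurable (A1 i)) -> (forall i, measurable (A2 i)) ->
    Q (f @^-1` rect A1 `&` g @^-1` rect A2) =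
    (Q (f @^-1` rect A1) * Q (g @^-1` rect A2))%E.
  move=> mA1 mA2.
  (* On a zeroed coordinate the constraint concerns the constant [0]: it is the full or the empty
     set, of probability one or zero. *)
  pose C1 (i : 'I_n) := if (i < k)%N then A1 i else [set _ | A1 i 0].
  pose C2 (i : 'I_n) := if (i < k)%N then [set _ | A2 i 0] else A2 i.
  have E1 : f @^-1` rect A1 = rect C1.
    apply/seteqP; split => y /= H i; have := H i; rewrite /C1 tnth_lmap_pid;
    by case: ifP.
  have E2 : g @^-1` rect A2 = rect C2.
    apply/seteqP; split => y /= H i; have := H i; rewrite /C2 tnth_lmap_copid;
    by case: ifP.
  have mC1 i : measurable (C1 i) by rewrite /C1; case: ifP.
  have mC2 i : measurable (C2 i) by rewrite /C2; case: ifP.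
  have E12 : f @^-1` rect A1 `&` g @^-1` rect A2 = rect (fun i => C1 i `&` C2 i).
    rewrite E1 E2; apply/seteqP; split => y /=.
      by move=> [H1 H2] i; split; [exact: H1|exact: H2].
    by move=> H; split => i; have [] := H i.
  rewrite E12 E1 E2 !gQ//; last by move=> i; exact: measurableI.
  rewrite -EFinM -big_split/=; congr _%:E; apply: eq_bigr => i _.
  rewrite -/(N i) /C1 /C2; case: ifP => _; rewrite Ncst.
    have [a|na] := asboolP (A2 i 0); rewrite ?mulr1 ?mulr0.
      by congr (fine (N i _)); apply/seteqP; split => x //= [].
    rewrite (_ : _ `&` _ = set0) ?N0//.
    by apply/seteqP; split => x //= [].
  have [a|na] := asboolP (A1 i 0); rewrite ?mul1r ?mul0r.
    by congr (fine (N i _)); apply/seteqP; split => x //= [].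
  rewrite (_ : _ `&` _ = set0) ?N0//.
  by apply/seteqP; split => x //= [].
have step2 A1 A2 : measurable A1 -> (forall i, measurable (A2 i)) ->
    Q (f @^-1` A1 `&` g @^-1` rect A2) =
    (Q (f @^-1` A1) * Q (g @^-1` rect A2))%E.
  move=> mA1 mA2; have mG := mgA _ (measurable_rect mA2).
  have q0 : 0 <= fine (Q (g @^-1` rect A2)) by rewrite fine_ge0.
  transitivity (mscale (NngNum q0) (image_measure Q mf) A1); last first.
    by rewrite /mscale/= fineK ?finQ// muleC.
  apply: (@tuple_measure_unique _ _ _ _ (image_measure (mrestr Q mG) mf)
    (mscale (NngNum q0) (image_measure Q mf))) => //.
    rewrite -ge0_fin_numE//.
    exact: (finQ _ (measurableI _ _ (mfA _ measurableT) mG)).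
  move=> C mC.
  transitivity (Q (f @^-1` rect C `&` g @^-1` rect A2)) => //.
  rewrite step1//.
  transitivity ((fine (Q (g @^-1` rect A2)))%:E * Q (f @^-1` rect C))%E => //.
  by rewrite fineK ?finQ// muleC.
have mF := mfA _ mA.
have q0 : 0 <= fine (Q (f @^-1` A)) by rewrite fine_ge0.
transitivity (mscale (NngNum q0) (image_measure Q mg) B); last first.
  by rewrite /mscale/= fineK ?finQ.
rewrite setIC.
apply: (@tuple_measure_unique _ _ _ _ (image_measure (mrestr Q mF) mg)
  (mscale (NngNum q0) (image_measure Q mg))) => //.
  rewrite -ge0_fin_numE//.
  exact: (finQ _ (measurableI _ _ (mgA _ measurableT) mF)).
move=> C mC.
transitivity (Q (f @^-1` A `&` g @^-1` rect C)).
  by rewrite setIC.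
rewrite step2//.
transitivity ((fine (Q (f @^-1` A)))%:E * Q (g @^-1` rect C))%E => //.
by rewrite fineK// finQ.
Qed.

(** The invariance hypotheses say that [A] depends only on the component in the range of [Pm], and
    [B] only on the complementary one. Diagonalizing [Pm] makes these two disjoint blocks of
    coordinates. *)
Lemma gauss_indep n (m : 'cV[R]_n) s (Q : {measure set (n.-tuple R) -> \bar R})
    (Pm : 'M[R]_n) (A B : set (n.-tuple R)) :
  s != 0 -> gauss m s Q -> Pm^T = Pm -> Pm *m Pm = Pm ->
  measurable A -> measurable B ->
  (forall y, A (lmap Pm y) <-> A y) ->
  (forall y, B (lmap (1%:M - Pm) y) <-> B y) ->
  Q (A `&` B) = (Q A * Q B)%E.
Proof.
move=> s0 gQ PT PP mA mB HA HB.
have [ O [k [gO OPO]]] := gauss_orth_proj PT PP.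
have OO := gO.1; have OO' := gauss_orthTr gO.
have mL := measurable_lmap O^T.
have mpre C : measurable C -> measurable (lmap O^T @^-1` C).
  by move=> mC; rewrite -[X in measurable X]setTI; exact: mL.
have PE : Pm = O^T *m pid_mx k *m O.
  by rewrite -OPO !mulmxA OO mul1mx -mulmxA OO mulmx1.
have PcE : 1%:M - Pm = O^T *m copid_mx k *m O.
  by rewrite /copid_mx mulmxBr mulmxBl mulmx1 OO PE.
have : Q (lmap O @^-1` (lmap (pid_mx k) @^-1` (lmap O^T @^-1` A) `&`
                        lmap (copid_mx k) @^-1` (lmap O^T @^-1` B))) =
    (Q (lmap O @^-1` (lmap (pid_mx k) @^-1` (lmap O^T @^-1` A))) *
     Q (lmap O @^-1` (lmap (copid_mx k) @^-1` (lmap O^T @^-1` B))))%E.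
  exact: (gauss_block k (gO.2 _ _ _ s0 gQ) (mpre _ mA) (mpre _ mB)).
have EA : lmap O @^-1` (lmap (pid_mx k) @^-1` (lmap O^T @^-1` A)) = A.
  by apply/seteqP; split => y /=; rewrite !lmapM ?mulmxA -PE => /HA.
have EB : lmap O @^-1` (lmap (copid_mx k) @^-1` (lmap O^T @^-1` B)) = B.
  by apply/seteqP; split => y /=; rewrite !lmapM ?mulmxA -PcE => /HB.
by rewrite preimage_setI EA EB.
Qed.

Lemma gauss_axis n (v : 'cV[R]_n) : v != 0 ->
  exists (k : 'I_n) (O : 'M[R]_n) (t : R),
    [/\ gauss_orth O, t != 0 & O *m v = t *: delta_mx k ord0].
Proof.
move=> v0; have n0 : (0 < n)%N.
  case: n v v0 => // v; apply: contraNT => _; apply/eqP/colP => -[] //.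
pose k := Ordinal n0.
have [//| O [t [gO t0 _ Ov]]] := @gauss_orth_to_axis _ _ k v v0.
by exists k, O, t.
Qed.

(** Once the normal vector is turned to an axis, the hyperplane fixes one coordinate at [c / t], and
    a normal law on the line has no atoms. *)
Lemma gauss_hyperplane n (m a : 'cV[R]_n) s c
    (Q : {measure set (n.-tuple R) -> \bar R}) :
  s != 0 -> gauss m s Q -> a != 0 ->
  Q [set y | (a^T *m cvec y) ord0 ord0 = c] = 0%E.
Proof.
move=> s0 gQ a0; have [k [ O [t [gO t0 Oa]]]] := gauss_axis a0.
have gQ' := gO.2 _ _ _ s0 gQ.
have := gauss_coord k gQ' (B := fun=> setT) (fun=> measurableT)
  (measurable_set1 (c / t)).
have -> : normal_prob ((O *m m) k ord0) s [set c / t] = 0%E.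
  by rewrite /normal_prob integral_set1.
rewrite mule0 => <-.
apply: (congr1 Q); apply/seteqP; split => y /=.
  move=> ac; split => //; apply: (mulIf t0); rewrite divfK// -ac.
  rewrite -(gauss_orth_isometry _ _ gO) Oa linearZ/= -scalemxAl mxE.
  by rewrite trmx_delta -rowE mxE mulrC /lmap tnth_mktuple.
move=> [yc _]; rewrite -(gauss_orth_isometry _ _ gO) Oa linearZ/= -scalemxAl mxE.
rewrite trmx_delta -rowE mxE; move: yc; rewrite /lmap tnth_mktuple => ->.
by rewrite mulrC divfK.
Qed.

(** The exponent is the logarithm of the ratio of the normal densities with means [m + t] and
    [m]. *)
Lemma normal_tilt (m t s : R) (B : set R) : s != 0 -> measurable B ->
  (\int[normal_prob m s]_(x in B)
     (expR (t * (x - m) / s ^+ 2 - t ^+ 2 / (s ^+ 2 *+ 2)))%:E =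
   normal_prob (m + t) s B)%E.
Proof.
move=> s0 mB.
have mh : measurable_fun [set: measurableTypeR R]
    (fun x : measurableTypeR R =>
       expR (t * (x - m) / s ^+ 2 - t ^+ 2 / (s ^+ 2 *+ 2)) : R).
  apply: measurableT_comp => //; apply: measurable_funB => //.
  apply: measurable_funM => //; apply: measurable_funM => //.
  exact: measurable_funB.
rewrite (@ge0_integral_density _ _ _ lebesgue_measure _ (normal_pdf m s)) //.
- apply: eq_integral => x _; rewrite -EFinM !normal_pdfE// /normal_fun.
  rewrite mulrCA -expRD; congr (_ * expR _)%:E.
  by field.
- exact: measurable_normal_pdf.
- by move=> x; exact: normal_pdf_ge0.
- exact/measurable_EFinP/measurable_funTS.
Qed.

(** Only the factor of coordinate [k] differs between the two product laws, so on a rectangle the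
    claim is [normal_tilt] times a common constant. *)
Lemma gauss_tilt_axis n (m : 'cV[R]_n) (k : 'I_n) (t s : R)
    (Q P : {measure set (n.-tuple R) -> \bar R}) (A : set (n.-tuple R)) :
  s != 0 -> gauss m s Q -> gauss (m + t *: delta_mx k ord0) s P -> measurable A ->
  P A = (\int[Q]_(y in A)
    (expR (t * (tnth y k - m k ord0) / s ^+ 2 - t ^+ 2 / (s ^+ 2 *+ 2)))%:E)%E.
Proof.
move=> s0 gQ gP.
pose h (x : R) := expR (t * (x - m k ord0) / s ^+ 2 - t ^+ 2 / (s ^+ 2 *+ 2)).
have mh : measurable_fun [set: R] (fun x => (h x)%:E).
  apply/measurable_EFinP; apply: measurableT_comp => //; apply: measurable_funB => //.
  apply: measurable_funM => //; apply: measurable_funM => //.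
  exact: measurable_funB.
have mhk : measurable_fun [set: n.-tuple R] (fun y => (h (tnth y k))%:E).
  by apply: (measurableT_comp mh); exact: measurable_tnth.
have h0 x : (0 <= (h x)%:E)%E by rewrite lee_fin expR_ge0.
move: A.
suff H A : measurable A -> P A = mdensity Q mhk (fun y => h0 (tnth y k)) A.
  by move=> A /H.
apply: tuple_measure_unique; first by rewrite (gaussT gP) ltry.
move=> B mB; rewrite gP//.
pose N := normal_prob (m k ord0) s.
have [mBk c0] : measurable (B k) /\
    0 <= \prod_(i | i != k) fine (normal_prob (m i ord0) s (B i)).
  by split => //; apply: prodr_ge0 => i _; rewrite fine_ge0.
set c := \prod_(i | i != k) _ in c0.
pose D : set (n.-tuple R) := rect (fun i => if i == k then setT else B i).
have mD : measurable D by apply: measurable_rect => i; case: ifP.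
have DE W : W `&` D = [set y | W y /\ forall i, i != k -> B i (tnth y i)].
  apply/seteqP; split => y /= [Wy H]; split => // i.
    by move=> ik; have := H i; rewrite (negbTE ik).
  by case: eqVneq => // ik; exact: H.
pose tk : n.-tuple R -> measurableTypeR R := fun y => tnth y k.
have mtk : measurable_fun setT tk by exact: measurable_tnth.
pose nu := image_measure (mrestr Q mD) mtk.
have rectB : rect B = (tk @^-1` B k) `&` D.
  rewrite DE; apply/seteqP; split => y /=; first by move=> H; split => // i _; exact: H.
  by move=> [Bk H] i; case: (eqVneq i k) => [->|] //; exact: H.
have mtB : measurable (tk @^-1` B k).
  rewrite -[X in measurable X]setTI; exact: (measurable_tnth k).
have nuE W : measurable W -> nu W = mscale (NngNum c0) N W.
  move=> mW; apply: etrans; last exact: (gauss_coord k gQ mB mW).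
  by apply: (congr1 Q); rewrite DE.
have E : mdensity Q mhk (fun y => h0 (tnth y k)) (rect B) =
    (\int[nu]_(x in B k) (h x)%:E)%E.
  apply: etrans; last first.
    apply/esym; apply: ge0_integral_pushforward; [exact: (mtk)|exact: (mBk)| |].
      exact: measurable_funTS.
    by move=> x _.
  apply: etrans; last first.
    apply/esym; apply: ge0_integral_mrestr; [exact: mtB| |by move=> y _; exact: h0].
    exact: measurable_funTS.
  by rewrite rectB.
apply: etrans; last exact: (esym E).
rewrite (@eq_measure_integral _ _ _ _ (mscale (NngNum c0) N)); last first.
  by move=> W mW _; exact: nuE.
rewrite ge0_integral_mscale//; last exact: measurable_funTS.
rewrite (normal_tilt _ _ s0 mBk) (bigD1 k)//=.
have -> : \prod_(i | i != k)
    fine (normal_prob ((m + t *: delta_mx k ord0) i ord0) s (B i)) = c.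
  by apply: eq_bigr => i ik; rewrite !mxE (negbTE ik) mulr0 addr0.
rewrite !mxE !eqxx mulr1 mulrC.
have [a ->] : exists a, normal_prob (m k ord0 + t) s (B k) = a%:E.
  by exists (fine (normal_prob (m k ord0 + t) s (B k))); rewrite fineK// fin_num_measure.
by rewrite EFinM.
Qed.

(** The Cameron-Martin formula. Its exponent consists of inner products, which the orthogonal map
    taking [v] to an axis preserves. *)
Lemma gauss_tilt n (m v : 'cV[R]_n) (s : R)
    (Q P : {measure set (n.-tuple R) -> \bar R}) (A : set (n.-tuple R)) :
  s != 0 -> gauss m s Q -> gauss (m + v) s P -> measurable A ->
  P A = (\int[Q]_(y in A)
    (expR ((v^T *m (cvec y - m)) ord0 ord0 / s ^+ 2 -
           (v^T *m v) ord0 ord0 / (s ^+ 2 *+ 2)))%:E)%E.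
Proof.
move=> s0 gQ gP mA.
(* The zero vector cannot be turned to an axis; in that case the density is one. *)
have [v0|v0] := eqVneq v 0.
  rewrite v0 addr0 in gP.
  have -> : P A = Q A.
    apply: tuple_measure_unique mA; first by rewrite (gaussT gP) ltry.
    by move=> B mB; rewrite (gP B mB) (gQ B mB).
  rewrite -[LHS]mul1e -(integral_cst Q mA) v0.
  apply: eq_integral => y _.
  rewrite trmx0 !mul0mx [X in X / _ - _]mxE [X in _ - X / _]mxE.
  by rewrite !mul0r subrr expR0.
have [k [ O [t [gO t0 Ov]]]] := gauss_axis v0.
have OO := gO.1; have OO' := gauss_orthTr gO.
have gQ' := gO.2 _ _ _ s0 gQ.
have gP' := gO.2 _ _ _ s0 gP.
rewrite mulmxDr Ov in gP'.
pose A' := lmap O^T @^-1` A.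
have mA' : measurable A'.
  by rewrite -[X in measurable X]setTI; exact: measurable_lmap.
have EA : lmap O @^-1` A' = A.
  by apply/seteqP; split => y; rewrite /A' /= lmapM OO lmap1.
have := gauss_tilt_axis s0 gQ' gP' mA'.
have -> : image_measure P (measurable_lmap O) A' = P A by rewrite image_measureE EA.
move=> ->; apply: etrans.
  apply: ge0_integral_pushforward; [exact: measurable_lmap|exact: mA'| |].
    apply/measurable_EFinP; apply: measurableT_comp => //; apply: measurable_funB => //.
    apply: measurable_funM => //; apply: measurable_funM => //.
    by apply: measurable_funB => //; apply: measurable_funTS; exact: measurable_tnth.
  by move=> x _; rewrite lee_fin expR_ge0.
rewrite EA; apply: eq_integral => y _ /=.
rewrite -(gauss_orth_isometry v (cvec y - m) gO) -(gauss_orth_isometry v v gO).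
rewrite Ov mulmxBr.
rewrite !linearZ/= -!scalemxAl trmx_delta -!rowE !mxE !eqxx mulr1.
by rewrite /lmap tnth_mktuple expr2 !mxE.
Qed.

End gauss.

(** * p-values given a statistic *)

Section pvalue.

(** The levels whose survival is at most [a] form an up-set [U], and the event says that [f y] lies
    in [U]. It is an increasing union of events [t n <= f y] with [t n] in [U], each of measure at
    most [a]; continuity from below concludes, whether or not the law of [f] has atoms. *)
Lemma pvalue_superuniform (d : measure_display) (T : measurableType d)
    (R : realType) (mu : {measure set T -> \bar R}) (f : T -> R) (a : R) :
  measurable_fun setT f -> 0 <= a ->
  (mu [set y | mu [set y' | f y' >= f y]%R <= a%:E] <= a%:E)%E.
Proof.
move=> mf a0.
pose surv (t : R) := mu [set y | t <= f y].
have mge t : measurable [set y | t <= f y].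
  rewrite (_ : [set y | t <= f y] = f @^-1` `[t, +oo[%classic).
    by rewrite -[X in measurable X]setTI; exact: mf.
  by apply/seteqP; split => y /=; rewrite in_itv/= andbT.
have survS t u : t <= u -> (surv u <= surv t)%E.
  by move=> tu; apply: le_measure; rewrite ?inE// => y /=; exact: le_trans.
pose U := [set t | (surv t <= a%:E)%E].
(* It remains to exhaust [U] by a nonincreasing sequence of its elements: [- n%:R] if [U] is
   unbounded below, the constant infimum if it is attained, and the infimum plus [n.+1%:R^-1]
   otherwise. *)
suff H (t : R^nat) : (forall n, U (t n)) ->
    (forall m n, (m <= n)%N -> t n <= t m) ->
    (forall u, U u -> exists n, t n <= u) ->
    (mu [set y | U (f y)] <= a%:E)%E.
  have [[u Uu]|U0] := pselect (U !=set0); last first.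
    rewrite (_ : [set y | _] = set0) ?measure0//.
    by apply/seteqP; split => y //= Uy; apply: U0; exists (f y).
  have Uup v w : v <= w -> U v -> U w.
    by rewrite /U/= => vw; apply: le_trans; exact: survS.
  have [lbU|nlbU] := pselect (has_lbound U); last first.
    apply: (H (fun n => - n%:R)).
    - move=> n; apply: contrapT => Un; apply: nlbU; exists (- n%:R) => v Uv.
      by rewrite leNgt; apply/negP => /ltW vn; apply: Un; exact: Uup Uv.
    - by move=> m n mn; rewrite lerN2 ler_nat.
    - move=> v _; exists (Num.truncn `|v|).+1.
      rewrite lerNl (le_trans (ler_norm _))// normrN ltW//.
      exact: truncnS_gt.
  have hiU : has_inf U by split => //; exists u.
  have [Ui|nUi] := pselect (U (inf U)).
    apply: (H (fun=> inf U)) => // v Uv; exists 0%N.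
    exact: ge_inf.
  apply: (H (fun n => inf U + n.+1%:R^-1)).
  - move=> n; have n0 : 0 < n.+1%:R^-1 :> R by rewrite invr_gt0.
    have [v Uv vn] := inf_adherent n0 hiU.
    exact: Uup (ltW vn) Uv.
  - by move=> m n mn; rewrite lerD2l lef_pV2 ?posrE// ler_nat.
  - move=> v Uv; have iv : inf U < v.
      rewrite lt_neqAle ge_inf// andbT; apply/eqP => iv; apply: nUi; by rewrite iv.
    exists (Num.truncn (v - inf U)^-1).
    rewrite -lerBrDl -[leRHS]invrK lef_pV2 ?posrE ?invr_gt0 ?subr_gt0//.
    by rewrite ltW// truncnS_gt.
move=> Ut tdec tU.
pose F n := [set y | t n <= f y].
have -> : [set y | U (f y)] = \bigcup_n F n.
  apply/seteqP; split => y /=; first by move=> /tU[n tn]; exists n.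
  move=> [n _ tn]; apply: (le_trans (survS _ _ tn)); exact: Ut.
apply: (@cvge_le _ _ _ _ (mu \o F)); last first.
  apply: nondecreasing_cvg_mu.
  - by move=> n; exact: mge.
  - by apply: bigcupT_measurable => n; exact: mge.
  - move=> m n mn; apply/subsetPset => y; rewrite /F /=; apply: le_trans; exact: tdec.
by apply: nearW => n; exact: Ut.
exact: eventually_filter.
Qed.

Context {d d' : measure_display} {T : measurableType d} {Z : measurableType d'}
  {R : realType}.

Section kfst.
Variable k : R.-pker Z ~> T.

(** The kernel pulled back to pairs: the p-value at a pair is then the kernel measure of a section,
    whose measurability is a general fact on kernels. *)
Definition kfst (x : Z * T) : {measure set T -> \bar R} := k x.1.

Let measurable_kfst U : measurable U -> measurable_fun setT (kfst ^~ U).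
Proof.
move=> mU; apply: (measurableT_comp (measurable_kernel k U mU)) => //.
Qed.

HB.instance Definition _ := isKernel.Build _ _ _ _ R kfst measurable_kfst.

Let kfst_prob x : kfst x setT = 1%E.
Proof. exact: prob_kernel. Qed.

HB.instance Definition _ := Kernel_isProbability.Build _ _ _ _ R kfst kfst_prob.

End kfst.

Section skew.
Variables (Q : {measure set T -> \bar R}) (S : T -> Z) (k : R.-pker Z ~> T) (D : set T).
Hypotheses (mS : measurable_fun setT S) (mD : measurable D).

(** For a conditional distribution [k], this is the law of the pair of [S y] and [y] on [D],
    computed by drawing [y] and then redrawing it from [k (S y)]. *)
Definition skew of measurable_fun setT S & measurable D :=
  fun W : set (Z * T) => (\int[Q]_(y in D) k (S y) (xsection W (S y)))%E.

Let mk W : measurable W -> measurable_fun D (fun y => k (S y) (xsection W (S y))).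
Proof.
move=> mW; apply: measurable_funTS.
apply: (@measurableT_comp _ _ _ _ _ _ (fun z => k z (xsection W z))) => //.
by apply: measurable_fun_xsection_finite_kernel; rewrite inE.
Qed.

Let skew0 : skew mS mD set0 = 0%E.
Proof. by rewrite [LHS]integral0_eq// => x/= _; rewrite xsection0. Qed.

Let skew_ge0 W : (0 <= skew mS mD W)%E.
Proof. exact: integral_ge0. Qed.

Let skew_sigma_additive : semi_sigma_additive (skew mS mD).
Proof.
move=> F mF tF mUF.
rewrite [X in _ --> X](_ : _ = \sum_(n <oo) skew mS mD (F n))%E.
  by apply/cvg_closeP; split; [exact: is_cvg_nneseries|rewrite closeE].
rewrite -integral_nneseries//; last by move=> n; exact: mk.
apply: eq_integral => x _; apply/esym/cvg_lim => //=; rewrite xsection_bigcup.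
apply: (measure_sigma_additive _ (trivIset_xsection tF)) => ?.
exact: measurable_xsection.
Qed.

HB.instance Definition _ := isMeasure.Build _ _ _ (skew mS mD)
  skew0 skew_ge0 skew_sigma_additive.

End skew.

(** A conditional distribution is tested on products of sets, but the event of a small p-value
    couples [y] with [S y], which calls for general [W]. Both sides are measures in [W] that agree
    on products. *)
Lemma regular_cond_dist_skew (Q : probability T R) (S : T -> Z)
    (k : R.-pker Z ~> T) (D : set T) (W : set (Z * T)) :
  measurable_fun setT S -> measurable D -> regular_cond_dist Q S D k ->
  measurable W ->
  Q ([set y | W (S y, y)] `&` D) = (\int[Q]_(y in D) k (S y) (xsection W (S y)))%E.
Proof.
move=> mS mD kQ mW.
have mp : measurable_fun setT (fun y => (S y, y)) by exact: measurable_fun_pair.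
pose nu := image_measure (mrestr Q mD) mp.
transitivity (nu W) => //.
transitivity (skew Q k mS mD W) => //.
apply: (measure_unique
  [set C | exists A1, measurable A1 /\ exists A2, measurable A2 /\ C = A1 `*` A2]
  (fun=> setT)) mW => //.
- rewrite measurable_prod_measurableType; congr (<<s _ >>).
  apply/seteqP; split => [_ [A mA [A' mA' <-]]|_ [A [mA [A' [mA' ->]]]]].
    by exists A; split => //; exists A'.
  by exists A => //; exists A'.
- move=> _ _ [A [mA [A' [mA' ->]]]] [C [mC [C' [mC' ->]]]].
  rewrite -setXI; exists (A `&` C); split; first exact: measurableI.
  by exists (A' `&` C'); split => //; exact: measurableI.
- by move=> _; exists setT; split => //; exists setT; split => //; rewrite setXTT.
- by rewrite bigcup_const.
- move=> _ [C [mC [B [mB ->]]]].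
  transitivity (Q (B `&` (S @^-1` C `&` D))).
    apply: (congr1 Q); apply/seteqP; split => y /=; first by move=> [[]].
    by move=> [By [Cy Dy]].
  rewrite (kQ _ _ mB mC).
  transitivity (\int[Q]_(y in D) k (S y) (xsection (C `*` B) (S y)))%E => //.
  rewrite setIC integral_mkcondr; apply: eq_integral => y _.
  rewrite /patch; case: ifPn => yC.
    by rewrite in_xsectionX// inE; move: yC; rewrite inE.
  rewrite notin_xsectionX ?measure0//.
- move=> _; apply: (@le_lt_trans _ _ 1%E); last exact: ltry.
  exact: (probability_le1 Q (measurableI _ _ measurableT mD)).
Qed.

Lemma measurable_pvalue_le (k : R.-pker Z ~> T) (f : T -> R) (a : R) :
  measurable_fun setT f ->
  measurable [set x : Z * T | (k x.1 [set y | f y >= f x.2]%R <= a%:E)%E].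
Proof.
move=> mf; pose p (x : Z * T) := k x.1 [set y' | f y' >= f x.2].
have mp : measurable_fun setT p.
  pose A : set ((Z * T) * T) := [set x | f x.1.2 <= f x.2].
  have mA : measurable A.
    rewrite (_ : A = (fun x => f x.1.2 <= f x.2) @^-1` [set true]); last first.
      by apply/seteqP; split => x.
    rewrite -[X in measurable X]setTI; apply: measurable_fun_ler => //.
      by apply: (measurableT_comp mf); exact: measurableT_comp.
    by apply: (measurableT_comp mf).
  have := @measurable_fun_xsection_finite_kernel _ _ _ _ _ (kfst k : R.-fker _ ~> _) A.
  rewrite inE => /(_ mA); congr (measurable_fun _ _).
  apply/funext => x; apply: (congr1 (k x.1)); apply/seteqP; split => y;
    by rewrite /xsection /= inE.
have := mp measurableT _ (emeasurable_itv `]-oo, a%:E]).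
by rewrite setTI.
Qed.

(** The set [C] of values of [S] is kept free so that a density depending on [S] can be brought in
    afterwards. *)
Lemma cond_pvalue_superuniform (Q : probability T R) (S : T -> Z)
    (k : R.-pker Z ~> T) (D : set T) (f : T -> R) (C : set Z) (a : R) :
  measurable_fun setT S -> measurable D -> measurable_fun setT f ->
  regular_cond_dist Q S D k -> measurable C -> 0 <= a ->
  (Q ([set y | k (S y) [set y' | f y' >= f y]%R <= a%:E] `&` (S @^-1` C `&` D))
   <= a%:E * Q (S @^-1` C `&` D))%E.
Proof.
move=> mS mD mf kQ mC a0.
have mV := measurable_pvalue_le k a mf; set V := [set x | _] in mV.
pose W := (fst @^-1` C) `&` V.
have mW : measurable W.
  apply: measurableI => //.
  by rewrite -[X in measurable X]setTI; exact: measurable_fst.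
have mSC : measurable (S @^-1` C).
  by rewrite -[X in measurable X]setTI; exact: mS.
have -> : [set y | k (S y) [set y' | f y' >= f y]%R <= a%:E]%E `&` (S @^-1` C `&` D) =
    [set y | W (S y, y)] `&` D.
  by apply/seteqP; split => y /=; [move=> [? []]|move=> [[]]].
rewrite (regular_cond_dist_skew mS mD kQ mW) setIC.
rewrite -(integral_cst Q (measurableI _ _ mD mSC)) integral_mkcondr.
apply: ge0_le_integral => //.
- apply: measurable_funTS.
  apply: (@measurableT_comp _ _ _ _ _ _ (fun z => k z (xsection W z))) => //.
  by apply: measurable_fun_xsection_finite_kernel; rewrite inE.
- apply/(measurable_restrict _ mSC mD); exact: measurable_cst.
move=> y _; rewrite /patch; case: ifPn => yC.
  (* On the section at [S y] the kernel defining the p-value is frozen, and it is also the measure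
     applied to the event: this is the setting of [pvalue_superuniform]. *)
  apply: (@le_trans _ _
    (k (S y) [set y1 | (k (S y) [set y' | f y' >= f y1]%R <= a%:E)%E])).
    apply: le_measure; rewrite ?inE.
    - exact: measurable_xsection.
    - rewrite (_ : [set y1 | _] = xsection V (S y)); first exact: measurable_xsection.
      by apply/seteqP; split => y1; rewrite /xsection/= inE.
    - by move=> y1; rewrite /xsection/= inE => -[].
  exact: pvalue_superuniform.
rewrite [X in k _ X](_ : _ = set0) ?measure0//.
apply/seteqP; split => y1 //; rewrite /xsection/= inE => -[Cy _].
by move: yC; rewrite notin_setE.
Qed.

(** With [C] arbitrary, [cond_pvalue_superuniform] compares two image measures on [Z]; integrating
    [h] against both replaces [Q] by [P] while the kernel stays the same. *)
Lemma density_pvalue_superuniform (Q : probability T R)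
    (P : {measure set T -> \bar R}) (S : T -> Z)
    (k : R.-pker Z ~> T) (D : set T) (f : T -> R) (h : Z -> R) (a : R) :
  measurable_fun setT S -> measurable D -> measurable_fun setT f ->
  regular_cond_dist Q S D k ->
  measurable_fun setT h -> (forall z, 0 <= h z) ->
  (forall A, measurable A -> P A = \int[Q]_(y in A) (h (S y))%:E)%E -> 0 <= a ->
  (P ([set y | k (S y) [set y' | f y' >= f y]%R <= a%:E] `&` D) <= a%:E * P D)%E.
Proof.
move=> mS mD mf kQ mh h0 PE a0.
set A := [set y | _].
have mp : measurable_fun setT (fun y => (S y, y)) by exact: measurable_fun_pair.
have mA : measurable A.
  have := mp measurableT _ (measurable_pvalue_le k a mf).
  by rewrite setTI.
have mAD : measurable (A `&` D) by exact: measurableI.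
have mh' : measurable_fun setT (fun z => (h z)%:E) by exact/measurable_EFinP.
have EP B (mB : measurable B) :
    P B = (\int[image_measure (mrestr Q mB) mS]_z (h z)%:E)%E.
  rewrite PE//; apply: etrans; last first.
    apply/esym; apply: ge0_integral_pushforward;
      [exact: mS|exact: measurableT|exact: (mh')|].
    by move=> z _; rewrite lee_fin.
  apply: etrans; last first.
    apply/esym; apply: ge0_integral_mrestr;
      [by rewrite preimage_setT; exact: measurableT| |].
    - by apply: measurable_funTS; exact: measurableT_comp.
    - by move=> z _; rewrite lee_fin.
  by rewrite preimage_setT setTI.
rewrite (EP _ mAD) (EP _ mD).
have -> : (a%:E * \int[image_measure (mrestr Q mD) mS]_z (h z)%:E =
    \int[mscale (NngNum a0) (image_measure (mrestr Q mD) mS)]_z (h z)%:E)%E.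
  by rewrite ge0_integral_mscale// => z _; rewrite lee_fin.
apply: ge0_le_measure_integral => //.
  move=> C mC.
  apply: (le_trans _ (cond_pvalue_superuniform mS mD mf kQ mC a0)).
  rewrite le_eqVlt; apply/orP; left; apply/eqP; apply: (congr1 Q).
  by rewrite setICA.
Qed.

End pvalue.

(** * The Lasso optimality conditions *)

Section lasso.
Context {R : realType} {n p : nat}.
Variables (X : 'M[R]_(n, p)) (y : 'cV[R]_n) (lambda : R).

(** Minus the gradient of the squared-error term, so that stationarity at a nonzero coefficient
    equates it with [lambda] times the sign. *)
Definition lasso_grad (b : 'cV[R]_p) : 'cV[R]_p := X^T *m (y - X *m b).

Lemma lasso_objD (b h : 'cV[R]_p) :
  lasso_obj X y lambda (b + h) = lasso_obj X y lambda b +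
    (2^-1 * (\sum_i (X *m h) i ord0 ^+ 2) -
     \sum_j lasso_grad b j ord0 * h j ord0 +
     lambda * \sum_j (`|b j ord0 + h j ord0| - `|b j ord0|)).
Proof.
have cross : \sum_i (y - X *m b) i ord0 * (X *m h) i ord0 =
    \sum_j lasso_grad b j ord0 * h j ord0.
  transitivity (((y - X *m b)^T *m (X *m h)) ord0 ord0).
    by rewrite mxE; apply: eq_bigr => i _; rewrite [in RHS]mxE.
  rewrite mulmxA -[X in X *m h]trmxK trmx_mul trmxK mxE.
  by apply: eq_bigr => j _; rewrite mxE.
rewrite /lasso_obj -cross sumrB.
have -> : \sum_j `|(b + h) j ord0| = \sum_j `|b j ord0 + h j ord0|.
  by apply: eq_bigr => j _; rewrite mxE.
have -> : \sum_i (y - X *m (b + h)) i ord0 ^+ 2 =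
    \sum_i (y - X *m b) i ord0 ^+ 2 -
    2 * (\sum_i (y - X *m b) i ord0 * (X *m h) i ord0) +
    \sum_i (X *m h) i ord0 ^+ 2.
  rewrite mulr_sumr -sumrB -big_split/=; apply: eq_bigr => i _.
  rewrite mulmxDr opprD addrA.
  rewrite [X in X ^+ 2 = _]mxE [X in _ + X]mxE.
  by ring.
by field.
Qed.

(** The quadratic term of the expansion is nonnegative, and the conditions make [lasso_grad b] a
    subgradient at [b] of [lambda] times the l1 norm. *)
Lemma lasso_kkt_suff (b b' : 'cV[R]_p) :
  (forall j, `|lasso_grad b j ord0| <= lambda) ->
  (forall j, b j ord0 != 0 -> lasso_grad b j ord0 = lambda * Num.sg (b j ord0)) ->
  lasso_obj X y lambda b <= lasso_obj X y lambda b'.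
Proof.
move=> gle geq; rewrite -(subrKC b b') lasso_objD lerDl.
set h := b' - b.
rewrite -addrA addr_ge0//.
  by rewrite mulr_ge0 ?invr_ge0// sumr_ge0// => i _; rewrite sqr_ge0.
rewrite addrC mulr_sumr subr_ge0; apply: ler_sum => j _.
have gb : lasso_grad b j ord0 * b j ord0 = lambda * `|b j ord0|.
  have [->|bj] := eqVneq (b j ord0) 0; first by rewrite normr0 !mulr0.
  by rewrite geq// -mulrA -normrEsg.
have gb' : lasso_grad b j ord0 * b' j ord0 <= lambda * `|b' j ord0|.
  by rewrite (le_trans (ler_norm _))// normrM ler_wpM2r.
have -> : b j ord0 + h j ord0 = b' j ord0 by rewrite !mxE subrKC.
have -> : h j ord0 = b' j ord0 - b j ord0 by rewrite !mxE.
by rewrite !mulrBr gb lerD2r.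
Qed.

(** Stands in for letting a step size tend to zero. *)
Lemma small_coef_le0 (a c : R) : 0 <= c ->
  (forall e, 0 < e < 1 -> a <= e * c) -> a <= 0.
Proof.
move=> c0 H; rewrite leNgt; apply/negP => a0.
have ac : 0 < 2 * (a + c) by rewrite mulr_gt0// ltr_wpDr.
(* This step size makes [e * c] smaller than half of [a]. *)
have /H : 0 < a / (2 * (a + c)) < 1.
  by rewrite divr_gt0//= ltr_pdivrMr// mul1r; lra.
rewrite -mulrA mulrCA -[leLHS]mul1r => Hle.
have : a * (2 * (a + c)) <= a * c.
  rewrite -ler_pdivlMr// -mulrA [c / _]mulrC; lra.
nra.
Qed.

Lemma lasso_kkt_nec (b : 'cV[R]_p) : 0 <= lambda ->
  (forall b', lasso_obj X y lambda b <= lasso_obj X y lambda b') ->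
  (forall j, `|lasso_grad b j ord0| <= lambda) /\
  (forall j, b j ord0 != 0 -> lasso_grad b j ord0 = lambda * Num.sg (b j ord0)).
Proof.
move=> l0 bmin.
have step j : exists2 c, 0 <= c & forall t,
    t * lasso_grad b j ord0 <= t ^+ 2 * c + lambda * (`|b j ord0 + t| - `|b j ord0|).
  exists (2^-1 * \sum_i X i j ^+ 2).
    by rewrite mulr_ge0 ?invr_ge0// sumr_ge0// => i _; rewrite sqr_ge0.
  move=> t; have := bmin (b + t *: delta_mx j ord0).
  rewrite lasso_objD lerDl.
  have -> : \sum_i (X *m (t *: delta_mx j ord0 : 'cV[R]_p)) i ord0 ^+ 2 =
      t ^+ 2 * \sum_i X i j ^+ 2.
    rewrite [RHS]mulr_sumr; apply: eq_bigr => i _.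
    by rewrite -scalemxAr -colE !mxE exprMn.
  have dE k : (t *: delta_mx j ord0 : 'cV[R]_p) k ord0 = t * (k == j)%:R.
    by rewrite !mxE eqxx andbT.
  have -> : \sum_k lasso_grad b k ord0 * (t *: delta_mx j ord0 : 'cV[R]_p) k ord0 =
      t * lasso_grad b j ord0.
    rewrite (bigD1 j)//= dE eqxx mulr1 big1 ?addr0 1?mulrC// => k /negbTE kj.
    by rewrite dE kj !mulr0.
  have -> : \sum_k (`|b k ord0 + (t *: delta_mx j ord0 : 'cV[R]_p) k ord0| -
      `|b k ord0|) =
      `|b j ord0 + t| - `|b j ord0|.
    rewrite (bigD1 j)//= dE eqxx mulr1 big1 ?addr0// => k /negbTE kj.
    by rewrite dE kj mulr0 addr0 subrr.
  by lra.
have gle j : `|lasso_grad b j ord0| <= lambda.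
  have [c c0 H] := step j; set g := lasso_grad b j ord0 in H *.
  (* Steps [e] and [- e] bound the gradient from both sides, since the penalty grows by at most
     [lambda * e]. *)
  rewrite -subr_le0; apply: (small_coef_le0 c0) => e /andP[e0 _].
  have He := H e; have He' := H (- e).
  have N1 : `|b j ord0 + e| - `|b j ord0| <= e.
    by rewrite lerBlDl (le_trans (ler_normD _ _))// (gtr0_norm e0).
  have N2 : `|b j ord0 - e| - `|b j ord0| <= e.
    by rewrite lerBlDl (le_trans (ler_normB _ _))// (gtr0_norm e0).
  have M1 := ler_wpM2l l0 N1; have M2 := ler_wpM2l l0 N2.
  have : e * `|g| <= e * (e * c + lambda).
    by case: (ler0P g) => _; rewrite mulrDr; nra.
  by rewrite ler_pM2l// => ?; lra.
split => // j bj; have [c c0 H] := step j.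
move: (gle j) H bj; set g := lasso_grad b j ord0; set bj := b j ord0 => gl H bj0.
have bg : lambda * `|bj| - bj * g <= 0.
  apply: (@small_coef_le0 _ (bj ^+ 2 * c)); first by rewrite mulr_ge0 ?sqr_ge0.
  (* Shrinking the coefficient by the factor [1 - e] keeps its sign, so the penalty changes linearly
     in [e]. *)
  move=> e /andP[e0 e1]; have := H (- e * bj).
  have -> : bj + - e * bj = (1 - e) * bj by ring.
  rewrite normrM (gtr0_norm (_ : 0 < 1 - e)); last by lra.
  move=> He; have : e * (lambda * `|bj| - bj * g) <= e * (e * (bj ^+ 2 * c)) by nra.
  by rewrite ler_pM2l.
have bg' : bj * g <= lambda * `|bj|.
  rewrite mulrC (le_trans (ler_norm _))// normrM.
  exact: ler_wpM2r.
have E : bj * g = lambda * `|bj| by lra.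
by apply: (mulfI bj0); rewrite E mulrCA [bj * _]mulrC -normrEsg.
Qed.

End lasso.

(** * Restriction to index sets, extension by zero, Gram matrices *)

Section subsets.
Context {R : realType}.

Lemma colsE n p (M : {set 'I_p}) (X : 'M[R]_(n, p)) :
  cols M X = X *m cols M 1%:M.
Proof. by rewrite /cols mulmx_colsub mulmx1. Qed.

Lemma rowsE n p (I : {set 'I_n}) (X : 'M[R]_(n, p)) :
  rows I X = rows I 1%:M *m X.
Proof. by rewrite /rows mul_rowsub_mx mul1mx. Qed.

Lemma enum_val_onto p (M : {set 'I_p}) j : j \in M ->
  exists k : 'I_#|M|, j = enum_val k.
Proof. by move=> jM; exists (enum_rank_in jM j); rewrite enum_rankK_in. Qed.

(** Multiplication by [cols M 1%:M] is extension by zero outside [M]. *)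
Lemma extend_in p (M : {set 'I_p}) (w : 'cV[R]_#|M|) k :
  (cols M 1%:M *m w) (enum_val k) ord0 = w k ord0.
Proof.
rewrite mxE (bigD1 k)//= big1 ?addr0.
  by rewrite !mxE eqxx mul1r.
move=> l lk; rewrite !mxE (_ : (_ == _) = false) ?mul0r//.
by apply/negbTE; rewrite (inj_eq enum_val_inj) eq_sym.
Qed.

Lemma extend_notin p (M : {set 'I_p}) (w : 'cV[R]_#|M|) j : j \notin M ->
  (cols M 1%:M *m w) j ord0 = 0.
Proof.
move=> jM; rewrite mxE big1// => l _.
rewrite !mxE (_ : (_ == _) = false) ?mul0r//.
by apply: contraNF jM => /eqP ->; exact: enum_valP.
Qed.

Lemma extend_rows p (M : {set 'I_p}) (b : 'cV[R]_p) :
  (forall j, j \notin M -> b j ord0 = 0) -> cols M 1%:M *m rows M b = b.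
Proof.
move=> b0; apply/colP => j; have [jM|jM] := boolP (j \in M).
  by have [k ->] := enum_val_onto jM; rewrite extend_in mxE.
by rewrite extend_notin// b0.
Qed.

Lemma gram_unitmx n m (X : 'M[R]_(n, m)) : \rank X = m -> X^T *m X \in unitmx.
Proof.
move=> rX; rewrite -row_free_unit -kermx_eq0; apply/rowV0P => v.
rewrite sub_kermx => /eqP vX.
have : (X *m v^T)^T *m (X *m v^T) = 0.
  by rewrite trmx_mul trmxK -mulmxA (mulmxA X^T) mulmxA vX mul0mx.
move=> /col_norm_eq0 /(congr1 trmx); rewrite trmx_mul trmxK trmx0 => vX0.
apply/eqP; rewrite -submx0; have : (v <= kermx X^T)%MS by rewrite sub_kermx vX0.
suff -> : kermx X^T = 0 by [].
by apply/eqP; rewrite kermx_eq0 /row_free mxrank_tr rX.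
Qed.

End subsets.

Section selection.
Context {R : realType} {n p : nat}.
Variables (X : 'M[R]_(n, p)) (y : 'cV[R]_n) (lambda : R) (St : {set 'I_p})
  (xi : 'cV[R]_#|St|).
Let X1 := cols St X.
Let w := invmx (X1^T *m X1) *m (X1^T *m y - lambda *: xi).

(** The vector [w] solves the stationarity equations on [St] with signs [xi]. Selection forces the
    coefficients on [St] to equal [w]; conversely, the zero extension of [w] satisfies the
    optimality conditions, and uniqueness identifies it with [b]. *)
Lemma lasso_selection (b : 'cV[R]_p) :
  0 < lambda -> X1^T *m X1 \in unitmx -> (forall k, `|xi k ord0| = 1) ->
  unique_argmin (lasso_obj X y lambda) b ->
  (supp b = St /\ has_signs xi b) <->
  (forall k, 0 < xi k ord0 * w k ord0) /\
  (forall j, j \notin St -> `|(X^T *m (y - X1 *m w)) j ord0| <= lambda).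
Proof.
move=> l0 gu xi1 bmin.
have bmin' b' : lasso_obj X y lambda b <= lasso_obj X y lambda b'.
  by have [->//|/bmin/ltW] := eqVneq b' b.
have gradE (r : 'cV[R]_n) (k : 'I_#|St|) :
    (X^T *m r) (enum_val k) ord0 = (X1^T *m r) k ord0.
  by rewrite !mxE; apply: eq_bigr => i _; rewrite !mxE.
split=> [[bS bxi]|[wxi inact]].
  have b0 j : j \notin St -> b j ord0 = 0.
    by rewrite -bS inE negbK => /eqP.
  have bE := extend_rows b0; set w' := rows St b in bE.
  have w'E k : w' k ord0 = b (enum_val k) ord0 by rewrite mxE.
  have bne (k : 'I_#|St|) : b (enum_val k) ord0 != 0.
    have : enum_val k \in supp b by rewrite bS; exact: enum_valP.
    by rewrite inE.
  have Xb : X *m b = X1 *m w' by rewrite -bE mulmxA -colsE.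
  have [gle geq] := lasso_kkt_nec (ltW l0) bmin'.
  have ww' : w' = w.
    have : X1^T *m (y - X1 *m w') = lambda *: xi.
      apply/colP => k; rewrite -gradE -Xb [RHS]mxE -bxi -geq//.
    rewrite mulmxBr /w => <-; rewrite opprB addrC subrK.
    by rewrite (mulmxA X1^T) mulmxA mulVmx// mul1mx.
  split=> [k|j _].
    by rewrite -ww' w'E -bxi -normrEsg normr_gt0.
  by rewrite -ww' -Xb; exact: gle.
pose b' := cols St 1%:M *m w.
have Xb' : X *m b' = X1 *m w by rewrite mulmxA -colsE.
have sgw k : Num.sg (w k ord0) = xi k ord0.
  have := wxi k; have /eqP := xi1 k.
  rewrite eqr_norml ler01 andbT => /orP[/eqP ->|/eqP ->].
    by rewrite mul1r => /gtr0_sg.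
  by rewrite mulN1r oppr_gt0 => /ltr0_sg.
have wne k : w k ord0 != 0.
  by have := wxi k; apply: contraTneq => ->; rewrite mulr0 ltxx.
have gin k : (X^T *m (y - X1 *m w)) (enum_val k) ord0 = lambda * xi k ord0.
  rewrite gradE mulmxBr (mulmxA X1^T) /w mulmxA mulmxV// mul1mx opprB addrC subrK.
  by rewrite mxE.
have b'b : b' = b.
  apply/eqP/negPn/negP => /bmin; rewrite ltNge => /negP; apply.
  apply: lasso_kkt_suff => j; rewrite /lasso_grad Xb'.
    have [jS|] := boolP (j \in St); last exact: inact.
    have [k ->] := enum_val_onto jS.
    by rewrite gin normrM xi1 mulr1 gtr0_norm.
  have [jS|jS] := boolP (j \in St); last by rewrite extend_notin ?eqxx.
  have [k ->] := enum_val_onto jS => _.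
  by rewrite gin extend_in sgw.
rewrite -b'b; split.
  apply/setP => j; rewrite inE; have [jS|jS] := boolP (j \in St).
    by have [k ->] := enum_val_onto jS; rewrite extend_in wne.
  by rewrite extend_notin// eqxx.
by move=> k; rewrite extend_in.
Qed.

End selection.

(** * The theorem *)

Section affine_sets.
Context {R : realType}.

Lemma measurable_lmap_rect m n (M : 'M[R]_(m, n)) (B : 'I_m -> set R) :
  (forall i, measurable (B i)) -> measurable (lmap M @^-1` rect B).
Proof.
move=> mB; rewrite -[X in measurable X]setTI.
by apply: measurable_lmap => //; exact: measurable_rect.
Qed.

Lemma gauss_open_closed m n (M : 'M[R]_(m, n)) (c : 'cV[R]_m) (mu : 'cV[R]_n)
    s (Q : {measure set (n.-tuple R) -> \bar R}) :
  s != 0 -> gauss mu s Q -> (forall k, row k M != 0) ->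
  Q [set y | forall k, c k ord0 < (M *m cvec y) k ord0] =
  Q [set y | forall k, c k ord0 <= (M *m cvec y) k ord0].
Proof.
move=> s0 gQ M0.
have mA B : (forall i : 'I_m, measurable (B i)) ->
    measurable [set y : n.-tuple R | forall k, B k ((M *m cvec y) k ord0)].
  move=> mB; rewrite (_ : [set y | _] = lmap M @^-1` rect B).
    exact: measurable_lmap_rect.
  by apply/seteqP; split => y /= H k; have := H k; rewrite /lmap tnth_mktuple.
set A := [set y | _]; set A' := [set y | _].
have mAo : measurable A.
  rewrite (_ : A = [set y | forall k, `]c k ord0, +oo[%classic ((M *m cvec y) k ord0)]).
    by apply: (mA (fun k => `]c k ord0, +oo[%classic)) => k; exact: measurable_itv.
  by apply/seteqP; split => y H k; have := H k; rewrite /= in_itv/= andbT.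
have mAc : measurable A'.
  rewrite (_ : A' = [set y | forall k, `[c k ord0, +oo[%classic ((M *m cvec y) k ord0)]).
    by apply: (mA (fun k => `[c k ord0, +oo[%classic)) => k; exact: measurable_itv.
  by apply/seteqP; split => y H k; have := H k; rewrite /= in_itv/= andbT.
pose H k := [set y : n.-tuple R | ((row k M)^T^T *m cvec y) ord0 ord0 = c k ord0].
have HE (y : n.-tuple R) k : ((row k M)^T^T *m cvec y) ord0 ord0 = (M *m cvec y) k ord0.
  by rewrite trmxK -row_mul mxE.
have mH k : measurable (H k).
  pose B l := if l == k then [set c k ord0] else [set: R].
  have mB l : measurable (B l) by rewrite /B; case: ifP.
  rewrite (_ : H k = [set y | forall l, B l ((M *m cvec y) l ord0)]); first exact: (mA B).
  apply/seteqP; split => y; rewrite /H/= HE; last by move=> /(_ k); rewrite /B eqxx.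
  by move=> yk l; rewrite /B; case: eqVneq => // ->.
(* The finite family is padded with empty sets to a sequence, to suit countable unions of negligible
   sets. *)
pose F (l : nat) := if insub l is Some k then H k else set0.
have negF : Q.-negligible (\bigcup_l F l).
  apply: negligible_bigcup => l; rewrite /F; case: insubP => [k _ _|_].
    have rk : (row k M)^T != 0.
      by have := M0 k; apply: contra_neq => /(congr1 trmx); rewrite trmxK trmx0.
    apply/negligibleP; first exact: mH.
    exact: (gauss_hyperplane (c k ord0) s0 gQ rk).
  exact: negligible_set0.
have negD : Q (A' `\` A) = 0%E.
  apply: measure_negligible; first exact: measurableD.
  apply: negligibleS negF => y [A'y nAy].
  have [k] : exists k, ~ (c k ord0 < (M *m cvec y) k ord0).
    by apply/existsNP => all; exact: nAy.
  move=> /negP; rewrite -leNgt => yc.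
  exists (val k) => //; rewrite /F; case: insubP => [k' _ /val_inj ->|].
    by rewrite /H/= HE; apply: le_anti; rewrite yc A'y.
  by rewrite ltn_ord.
have AA' : A `<=` A' by move=> y Ay k; exact: ltW.
rewrite -(setDUK AA') measureU//.
- by rewrite [X in (_ + X)%E](_ : _ = 0%E) ?adde0.
- exact: measurableD.
- by rewrite setDIK.
Qed.

End affine_sets.

(** * The law of the response *)

Section model.
Context {R : realType} {n : nat} {d : measure_display} {Omega : measurableType d}.
Variables (P : probability Omega R) (eps : {RV P >-> n.-tuple R})
  (Y : Omega -> n.-tuple R) (m : 'cV[R]_n) (sigma : R).
Hypothesis YE : forall w, cvec (Y w) = m + cvec (eps w).

Let tnthY w i : tnth (Y w) i = tnth (eps w) i + m i ord0.
Proof.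
by have /colP/(_ i) := YE w; rewrite !mxE => ->; rewrite addrC.
Qed.

Lemma measurable_model : measurable_fun setT Y.
Proof.
apply/measurable_fun_tnthP => i.
rewrite (_ : _ \o _ = (fun w => tnth (eps w) i + m i ord0)); last first.
  by apply/funext => w /=; rewrite tnthY.
apply: measurable_funD => //.
by apply: (measurableT_comp (measurable_tnth i)).
Qed.

Lemma gauss_model : sigma != 0 ->
  gaussian_law 0 sigma (distribution P eps) ->
  gauss m sigma (image_measure P measurable_model).
Proof.
move=> s0 /gaussian_law_gauss law B mB.
pose B' i := (fun x : R => x + m i ord0) @^-1` B i.
have mB' i : measurable (B' i).
  have mt : measurable_fun [set: R] (fun x : R => x + m i ord0).
    exact: measurable_funD.
  by rewrite -[X in measurable X]setTI; apply: mt => //; exact: mB.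
transitivity (distribution P eps (rect B')).
  by apply: (congr1 P); apply/seteqP; split => w H i; have := H i; rewrite /B' /= tnthY.
have E i : normal_prob ((0 : 'cV[R]_n) i ord0) sigma (B' i) =
    normal_prob (m i ord0) sigma (B i).
  rewrite /B' (normal_prob_translate _ _ (mB i) s0).
  by rewrite [X in X + _]mxE add0r.
by rewrite (law B' mB'); under eq_bigr do rewrite E.
Qed.

End model.

(** * The residual projection of the selection data *)

Section projection.
Context {R : realType} {n s : nat}.
Variables (I : {set 'I_n}) (X : 'M[R]_(n, s)).
Let J := rows I (1%:M : 'M[R]_n).
Let X1 := rows I X.
Hypothesis X1u : X1^T *m X1 \in unitmx.
Let H := invmx (X1^T *m X1).

(* The projection onto the vectors supported on [I] whose restriction to [I] is
   orthogonal to the columns of [X1]. *)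
Definition residual_proj : 'M[R]_n := J^T *m (1%:M - X1 *m H *m X1^T) *m J.

Lemma rows_rowsT : J *m J^T = 1%:M.
Proof.
apply/matrixP => k l; rewrite !mxE (bigD1 (enum_val k))//= big1 ?addr0.
  by rewrite !mxE eqxx mul1r (inj_eq enum_val_inj) eq_sym.
by move=> j jk; rewrite !mxE eq_sym (negbTE jk) mul0r.
Qed.

Lemma hat_residual : X1^T *m (1%:M - X1 *m H *m X1^T) = 0.
Proof. by rewrite mulmxBr mulmx1 !mulmxA mulmxV// mul1mx subrr. Qed.

Let HT : H^T = H.
Proof. by rewrite /H trmx_inv trmx_mul trmxK. Qed.

Let residualT : (1%:M - X1 *m H *m X1^T)^T = 1%:M - X1 *m H *m X1^T.
Proof. by rewrite linearB/= trmx1 !trmx_mul trmxK HT mulmxA. Qed.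

Let residual_idem : (1%:M - X1 *m H *m X1^T) *m (1%:M - X1 *m H *m X1^T) =
  1%:M - X1 *m H *m X1^T.
Proof.
by rewrite [LHS]mulmxBl mul1mx -(mulmxA _ X1^T) hat_residual mulmx0 subr0.
Qed.

Lemma residual_projT : residual_proj^T = residual_proj.
Proof. by rewrite /residual_proj !trmx_mul trmxK residualT mulmxA. Qed.

Lemma rows_residual_proj : J *m residual_proj = (1%:M - X1 *m H *m X1^T) *m J.
Proof. by rewrite /residual_proj !mulmxA rows_rowsT mul1mx. Qed.

Lemma residual_proj_idem : residual_proj *m residual_proj = residual_proj.
Proof.
rewrite {1}/residual_proj -[LHS]mulmxA rows_residual_proj mulmxA.
by rewrite -[_ *m _ *m (_ - _)]mulmxA residual_idem.
Qed.

Lemma residual_residual_proj :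
  (1%:M - X1 *m H *m X1^T) *m J *m residual_proj = (1%:M - X1 *m H *m X1^T) *m J.
Proof. by rewrite -mulmxA rows_residual_proj mulmxA residual_idem. Qed.

Lemma rows_trmx_residual_proj : X1^T *m J *m residual_proj = 0.
Proof. by rewrite -mulmxA rows_residual_proj mulmxA hat_residual mul0mx. Qed.

(** All rows of [X] occur here, not only those in [I]. A residual is supported on [I], so its
    product with a full column sees only the rows in [I]; hence the statistics of the whole sample
    ignore it. *)
Lemma trmx_residual_proj : X^T *m residual_proj = 0.
Proof.
have -> : X^T *m residual_proj = (J *m X)^T *m (1%:M - X1 *m H *m X1^T) *m J.
  by rewrite trmx_mul /residual_proj !mulmxA.
by rewrite /J -rowsE hat_residual mul0mx.
Qed.

End projection.

Lemma cprob_le (d : measure_display) (T : measurableType d) (R : realType)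
    (P : probability T R) (B E : set T) (a : R) :
  measurable E -> (0 < P E)%E -> (P (B `&` E) <= a%:E * P E)%E -> cprob P B E <= a.
Proof.
move=> mE E0 H.
have [e eE] : exists e, P E = e%:E.
  by exists (fine (P E)); rewrite fineK// fin_num_measure.
move: E0 H; rewrite /cprob eE lte_fin -EFinM/= => e0.
have : (0 <= P (B `&` E))%E by [].
case: (P (B `&` E)) => [r| |]// _.
by rewrite lee_fin /= ler_pdivrMr.
Qed.

Theorem theorem4 (R : realType) (n p : nat) (X : 'M[R]_(n, p))
  (beta : 'cV[R]_p) (sigma : R) (sigma_gt0 : 0 < sigma)
  (d : measure_display) (Omega : measurableType d) (P : probability Omega R)
  (eps : {RV P >-> n.-tuple R})
  (eps_law : gaussian_law 0 sigma (distribution P eps))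
  (Y : Omega -> n.-tuple R)
  (Y_model : forall w, cvec (Y w) = X *m beta + cvec (eps w))
  (n1 n2 : nat) (I : {set 'I_n}) (card_I : #|I| = n1) (card_IC : #|~: I| = n2)
  (lambda : R) (lambda_gt0 : 0 < lambda)
  (betahat : Omega -> 'cV[R]_p)
  (betahat_lasso : forall w,
    unique_argmin (lasso_obj (rows I X) (rows I (cvec (Y w))) lambda)
                  (betahat w))
  (St : {set 'I_p}) (xi : 'cV[R]_#|St|)
  (E : set Omega)
  (E_def : E = [set w | supp (betahat w) = St /\ has_signs xi (betahat w)])
  (E_gt0 : (0 < P E)%E)
  (screening : supp beta \subset St)
  (St_lt : (#|St| < n1)%N)
  (St_rank : \rank (rows I (cols St X)) = #|St|)
  (G : {set 'I_p})
  (betaSt : 'cV[R]_#|St|)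
  (betaSt_G : forall k : 'I_#|St|,
    enum_val k \in (G :&: St)%SET -> betaSt k ord0 = 0)
  (Q : probability (n.-tuple R) R)
  (Q_law : gaussian_law (cols St X *m betaSt) sigma Q)
  (K : R.-pker #|St :\: (G :&: St)|.-tuple R ~> n.-tuple R)
  (K_cond : regular_cond_dist Q (nuisance_stat X St (G :&: St)%SET)
              (active_event X I lambda xi) K)
  (null_hyp : forall j, j \in G -> beta j ord0 = 0)
  (alpha : R) (alpha_bnd : 0 < alpha <= 1) :
  cprob P [set w | (group_pvalue X xi K (Y w) <= alpha%:E)%E] E <= alpha.
Proof.
have s0 : sigma != 0 by rewrite gt_eqF.
have /andP[a0 a1] := alpha_bnd.
have X1u := gram_unitmx St_rank.
(* The event [E] has positive probability, so some outcome realizes [xi] as signs of nonzero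
   coefficients. *)
have xi1 k : `|xi k ord0| = 1.
  have [w Ew] : exists w, E w.
    apply: contrapT => nE; move: E_gt0; rewrite (_ : E = set0) ?measure0 ?ltxx//.
    by apply/seteqP; split => w // Ew; apply: nE; exists w.
  move: Ew; rewrite E_def => -[bS bxi]; rewrite -bxi.
  have bk : enum_val k \in supp (betahat w) by rewrite bS; exact: enum_valP.
  by rewrite normr_sg; move: bk; rewrite inE => ->.
set Gt := (G :&: St)%SET in K K_cond *.
set XS := cols St X in X1u *.
set X1 := rows I XS in X1u *.
pose H : 'M[R]_#|St| := invmx (X1^T *m X1).
pose J := rows I (1%:M : 'M[R]_n).
pose N := residual_proj I XS.
have mY := measurable_model Y_model.
pose PY := image_measure P mY.
have gPY : gauss (X *m beta) sigma PY := gauss_model Y_model s0 eps_law.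
have gQ := gaussian_law_gauss Q_law.
pose Dxi := diag_mx xi^T.
(* Both constraint systems are put as affine conditions on the whole vector [y]. The active one is
   negated relative to [active_event]; the inactive one bounds the Lasso gradient outside [St]. *)
pose MA := Dxi *m H *m X1^T *m J.
pose cA := lambda *: (Dxi *m H *m xi).
pose MI := (rows I X)^T *m ((1%:M - X1 *m H *m X1^T) *m J).
pose cI := lambda *: ((rows I X)^T *m X1 *m H *m xi).
pose D0 := [set y : n.-tuple R | forall k, cA k ord0 < (MA *m cvec y) k ord0].
pose Inact := [set y : n.-tuple R | forall j, j \notin St ->
  `|(MI *m cvec y) j ord0 + cI j ord0| <= lambda].
have rowsJ (y : 'cV[R]_n) : rows I y = J *m y by rewrite rowsE.
have DE : active_event X I lambda xi =
    [set y | forall k, cA k ord0 <= (MA *m cvec y) k ord0].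
  apply/seteqP; split => y; cbv beta zeta delta [active_event mkset] => Hy k; have := Hy k.
    rewrite rowsJ !mulNmx scaleNr [X in X <= _ -> _]mxE [X in _ <= X -> _]mxE lerN2.
    by rewrite /MA /cA -!mulmxA.
  rewrite rowsJ !mulNmx scaleNr [X in _ -> X <= _]mxE [X in _ -> _ <= X]mxE lerN2.
  by rewrite /MA /cA -!mulmxA.
have X1E : X1 = cols St (rows I X) by apply/matrixP => i k; rewrite !mxE.
have EE : E = Y @^-1` (D0 `&` Inact).
  rewrite E_def; apply/seteqP.
  suff sel w : (supp (betahat w) = St /\ has_signs xi (betahat w)) <->
      (D0 (Y w) /\ Inact (Y w)) by split => w /sel.
  have X1u' := X1u; rewrite X1E in X1u'.
  apply: iff_trans (lasso_selection lambda_gt0 X1u' xi1 (betahat_lasso w)) _.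
  rewrite -X1E -/H; set y1 := rows I (cvec (Y w)).
  have actE k : xi k ord0 * (H *m (X1^T *m y1 - lambda *: xi)) k ord0 =
      (MA *m cvec (Y w)) k ord0 - cA k ord0.
    transitivity ((Dxi *m (H *m (X1^T *m y1 - lambda *: xi))) k ord0).
      by rewrite /Dxi mul_diag_mx !mxE.
    rewrite mulmxBr -scalemxAr mulmxBr -scalemxAr [LHS]mxE [X in _ + X]mxE.
    by rewrite /MA /cA /y1 rowsJ !mulmxA.
  have inactE j :
      ((rows I X)^T *m (y1 - X1 *m (H *m (X1^T *m y1 - lambda *: xi)))) j ord0 =
      (MI *m cvec (Y w)) j ord0 + cI j ord0.
    have -> : y1 - X1 *m (H *m (X1^T *m y1 - lambda *: xi)) =
        (1%:M - X1 *m H *m X1^T) *m y1 + lambda *: (X1 *m H *m xi).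
      rewrite mulmxBl mul1mx !mulmxBr -!scalemxAr !mulmxA opprB.
      by rewrite addrA addrAC.
    rewrite mulmxDr -scalemxAr [LHS]mxE /MI /cI /y1 rowsJ.
    by rewrite !mulmxA.
  split=> -[H1 H2]; split.
  - by move=> k; have := H1 k; rewrite actE subr_gt0.
  - by move=> j jS; rewrite -inactE; exact: H2.
  - by move=> k; rewrite actE subr_gt0.
  - by move=> j jS; rewrite inactE; exact: H2.
have mD0 : measurable D0.
  rewrite (_ : D0 = lmap MA @^-1` rect (fun k => `]cA k ord0, +oo[%classic)).
    by apply: measurable_lmap_rect => k; exact: measurable_itv.
  apply/seteqP; split => y Hy k; have := Hy k;
    by rewrite /= in_itv/= andbT /lmap tnth_mktuple.
have mD : measurable (active_event X I lambda xi).
  rewrite DE (_ : [set y | _] = lmap MA @^-1` rect (fun k => `[cA k ord0, +oo[%classic)).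
    by apply: measurable_lmap_rect => k; exact: measurable_itv.
  apply/seteqP; split => y Hy k; have := Hy k;
    by rewrite /= in_itv/= andbT /lmap tnth_mktuple.
have mInact : measurable Inact.
  rewrite (_ : Inact = lmap MI @^-1` rect (fun j => if j \in St then setT else
      `[- lambda - cI j ord0, lambda - cI j ord0]%classic)).
    by apply: measurable_lmap_rect => j; case: ifP => _ //; exact: measurable_itv.
  have itvE j x : (`|x + cI j ord0| <= lambda) =
      (x \in `[- lambda - cI j ord0, lambda - cI j ord0]).
    by rewrite in_itv/= ler_norml lerBlDr lerBrDr.
  apply/seteqP; split => y Hy j; have := Hy j; rewrite /lmap tnth_mktuple/=.
    by case: ifPn => // jS /(_ isT); rewrite itvE.
  by move=> + jS; rewrite (negbTE jS) itvE.
have mE : measurable E.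
  rewrite EE -[X in measurable X]setTI.
  exact: (mY measurableT _ (measurableI _ _ mD0 mInact)).
apply: cprob_le => //.
set B := [set w | _].
(* With an empty group the p-value is constantly one, so the event is empty unless [alpha] is
   one. *)
have [Gt0|Gt0] := leqP #|Gt| 0.
  have pE w : group_pvalue X xi K (Y w) = 1%E.
    by rewrite /group_pvalue -/Gt ltnNge Gt0.
  have [a1'|a1'] := leP 1 alpha.
    have -> : alpha = 1 by apply: le_anti; rewrite a1.
    have -> : B = setT by apply/seteqP; split => w //=; rewrite /B/= pE lee_fin.
    by rewrite mul1e setTI.
  have -> : B = set0.
    by apply/seteqP; split => w //; rewrite /B/= pE lee_fin leNgt a1'.
  by rewrite set0I measure0 mule_ge0// lee_fin ltW.
have BE : B = [set w | (K (nuisance_stat X St Gt (Y w))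
    [set y' | group_stat X xi Gt y' >= group_stat X xi Gt (Y w)]%R <= alpha%:E)%E].
  by apply/seteqP; split => w; rewrite /B/= /group_pvalue -/Gt Gt0.
rewrite {}BE {B}.
pose M := (St :\: Gt)%SET.
pose f := group_stat X xi Gt.
pose S := nuisance_stat X St Gt.
pose A := [set y : n.-tuple R | (K (S y) [set y' | f y' >= f y]%R <= alpha%:E)%E].
have mf : measurable_fun setT f.
  rewrite (_ : f = (fun y => \sum_k if enum_val k \in Gt then
      xi k ord0 * tnth (lmap (left_inv XS) y) k else 0)).
    apply: measurable_sum => k; case: (enum_val k \in Gt); last exact: measurable_cst.
    apply: measurable_funM; first exact: measurable_cst.
    exact: (measurableT_comp (measurable_tnth k) (measurable_lmap _)).
  apply/funext => y; rewrite /f /group_stat big_mkcond; apply: eq_bigr => k _.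
  by rewrite /lmap tnth_mktuple.
have mS : measurable_fun setT S by exact: measurable_lmap.
have mA : measurable A.
  have mp : measurable_fun setT (fun y => (S y, y)) by exact: measurable_fun_pair.
  have := mp measurableT _ (measurable_pvalue_le K alpha mf).
  by rewrite setTI.
have XN : XS^T *m N = 0 by exact: trmx_residual_proj.
have XmN : (cols M X)^T *m N = 0.
  apply/matrixP => k l; rewrite [RHS]mxE.
  have kS : enum_val k \in St by have := enum_valP k; rewrite inE => /andP[].
  have [k' kk'] := enum_val_onto kS.
  transitivity ((XS^T *m N) k' l); last by rewrite XN mxE.
  by rewrite [LHS]mxE [RHS]mxE; apply: eq_bigr => i _; rewrite !mxE kk'.
(* The last factor of [left_inv XS] is [XS^T], which annihilates [N]; the nuisance columns are among
   those of [XS]. *)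
have A_inv y : A (lmap (1%:M - N) y) <-> A y.
  have -> : A (lmap (1%:M - N) y) = A y; last by [].
  have fE : f (lmap (1%:M - N) y) = f y.
    rewrite /f /group_stat cvec_lmap; apply: eq_bigr => k _; congr (_ * _).
    rewrite /left_inv -/XS mulmxBl mul1mx mulmxBr (mulmxA _ N) -(mulmxA _ XS^T N) XN.
    by rewrite mulmx0 mul0mx subr0.
  have SE : S (lmap (1%:M - N) y) = S y.
    rewrite /S /nuisance_stat cvec_lmap mulmxBl mul1mx mulmxBr (mulmxA _ N) XmN.
    by rewrite mul0mx subr0.
  by rewrite /A/= fE SE.
have D0_inv y : D0 (lmap (1%:M - N) y) <-> D0 y.
  have E0 : MA *m cvec (lmap (1%:M - N) y) = MA *m cvec y.
    have MAN : MA *m N = 0.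
      rewrite /MA -(mulmxA (Dxi *m H)) -(mulmxA (Dxi *m H)).
      by rewrite [X in _ *m X](rows_trmx_residual_proj X1u) mulmx0.
    by rewrite cvec_lmap mulmxBl mul1mx mulmxBr (mulmxA MA N) MAN mul0mx subr0.
  by split => Hy k; have := Hy k; rewrite E0.
have Inact_inv y : Inact (lmap N y) <-> Inact y.
  have E0 : MI *m cvec (lmap N y) = MI *m cvec y.
    rewrite cvec_lmap (mulmxA MI N) /MI -(mulmxA (rows I X)^T).
    by rewrite (residual_residual_proj X1u).
  by split => Hy j jS; have := Hy j jS; rewrite E0.
have indep (B : set (n.-tuple R)) :
    measurable B -> (forall y, B (lmap (1%:M - N) y) <-> B y) ->
    PY (Inact `&` B) = (PY Inact * PY B)%E.
  move=> mB HB; apply: (gauss_indep s0 gPY (residual_projT _ _) _ mInact mB Inact_inv HB).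
  exact: residual_proj_idem.
have PD0 : PY D0 = PY (active_event X I lambda xi).
  rewrite DE; apply: (gauss_open_closed cA s0 gPY) => k.
  (* Multiplication by [XS] turns [MA] into [Dxi], whose diagonal entries have modulus one, so no
     row of [MA] vanishes. *)
  apply/eqP => rk0; have : row k (MA *m XS) = 0 by rewrite row_mul rk0 mul0mx.
  have -> : MA *m XS = Dxi.
    by rewrite /MA -!mulmxA -rowsE -/X1 /H mulVmx// mulmx1.
  move=> /matrixP /(_ ord0 k); rewrite !mxE eqxx mulr1n => xik.
  by have := xi1 k; rewrite xik normr0 => /eqP; rewrite eq_sym oner_eq0.
(* [betaSt] is prescribed only on the group, so the two means may differ; this is the difference of
   their coefficient vectors. *)
pose delta := beta - cols St 1%:M *m betaSt.
have delta0 j : j \notin M -> delta j ord0 = 0.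
  rewrite inE negb_and negbK => jM; rewrite /delta mxE [X in _ + X]mxE.
  have [jS|jS] := boolP (j \in St).
    have jG : j \in Gt by move: jM; rewrite jS orbF.
    have [k jk] := enum_val_onto jS; rewrite jk extend_in.
    rewrite null_hyp; last by rewrite -jk; move: jG; rewrite inE => /andP[].
    by rewrite betaSt_G ?subr0// -jk.
  rewrite extend_notin// subr0; apply/eqP; apply: contraNT jS => bj.
  by apply: (fintype.subsetP screening); rewrite inE.
pose c := rows M delta.
pose v := cols M X *m c.
have vE : X *m beta = XS *m betaSt + v.
  by rewrite /v /c colsE -mulmxA extend_rows// mulmxBr mulmxA -colsE addrC subrK.
rewrite vE in gPY.
(* The Cameron-Martin density of the law of [Y] relative to [Q]. As [v] is [cols M X *m c], its
   inner product with [y] is that of [c] with the nuisance statistic. *)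
pose h (z : #|M|.-tuple R) := expR
  ((tnth (lmap c^T z) ord0 - (v^T *m (XS *m betaSt)) ord0 ord0) / sigma ^+ 2 -
   (v^T *m v) ord0 ord0 / (sigma ^+ 2 *+ 2)).
have mh : measurable_fun setT h.
  apply: measurableT_comp => //; apply: measurable_funB; last exact: measurable_cst.
  apply: measurable_funM; last exact: measurable_cst.
  apply: measurable_funB; last exact: measurable_cst.
  exact: (measurableT_comp (measurable_tnth ord0) (measurable_lmap _)).
have PYE B : measurable B -> PY B = (\int[Q]_(y in B) (h (S y))%:E)%E.
  move=> mB; rewrite (gauss_tilt s0 gQ gPY mB); apply: eq_integral => y _.
  have E1 : (v^T *m (cvec y - XS *m betaSt)) ord0 ord0 =
      tnth (lmap c^T (S y)) ord0 - (v^T *m (XS *m betaSt)) ord0 ord0.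
    rewrite mulmxBr [LHS]mxE [X in _ + X]mxE; congr (_ - _).
    by rewrite /lmap tnth_mktuple /S /nuisance_stat tvecK mulmxA /v trmx_mul.
  by rewrite E1.
have main := density_pvalue_superuniform mS mD mf K_cond mh
  (fun z => expR_ge0 _) PYE (ltW a0).
(* The factor [PY Inact] is split off from [P E] and, by the invariance of [A] and [D0], from the
   left side as well. *)
have -> : P E = PY (Inact `&` D0) by rewrite EE setIC.
rewrite (indep _ mD0 D0_inv).
apply: (@le_trans _ _ (PY Inact * PY (A `&` D0))%E).
  rewrite -indep; last 2 first.
  - exact: measurableI.
  - by move=> y; rewrite /setI/=; split => -[/A_inv Ay /D0_inv D0y].
  rewrite le_eqVlt; apply/orP; left; apply/eqP; apply: (congr1 P).
  rewrite EE; apply/seteqP; split => w /=; first by move=> [Aw [D0w Iw]].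
  by move=> [Iw [Aw D0w]].
rewrite muleCA; apply: lee_wpmul2l; first exact: measure_ge0.
(* [main] is about the weak inequalities: passing to [D0] only shrinks the event on the left, and
   [PD0] keeps the right side unchanged. *)
rewrite PD0; apply: (le_trans _ main); apply: le_measure; rewrite ?inE.
- exact: measurableI.
- exact: measurableI.
- by apply: setIS; rewrite DE => y D0y k; exact: ltW.
Qed.
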